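(* Let $A$ be a torsion-free abelian group and $G$ a group acting on $A$ by automorphisms such that every $G$-orbit in $A$ is finite. If $\mathrm{C}(\hat A)^G \cong \mathrm{C}(\mathbb{T}^n)$ for some $n \in \mathbb{N}$, then $A \cong \mathbb{Z}^n$ and $G$ acts trivially on $A$.
   Context: $\hat A = \mathrm{Hom}(A, \mathrm{S}^1)$ is the Pontryagin dual, a compact abelian group with the topology of pointwise convergence. Each automorphism $\alpha$ of $A$ induces a continuous automorphism $\chi \mapsto \chi\circ\alpha$ of $\hat A$, so $G$ acts on $\hat A$ and thus by *-automorphisms on $\mathrm{C}(\hat A)$ (equivalently on $\mathrm{C}^*(A) \cong \mathrm{C}(\hat A)$ via the Fourier transform). $\mathrm{C}(\hat A)^G$ denotes the fixed point algebra $\{x \mid gx = x \text{ for all } g \in G\}$. *)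

(* Defs.v *)
From HB Require Import structures.
From mathcomp Require Import all_boot all_order all_algebra.
From mathcomp Require Import monoid.
From mathcomp Require Import all_classical all_reals all_analysis.
From mathcomp Require Import complex.
From mathcomp Require Import Rstruct Rstruct_topology.
Import numFieldTopology.Exports numFieldNormedType.Exports.
Import GRing.Theory Num.Theory.

Set Implicit Arguments.
Unset Strict Implicit.
Unset Printing Implicit Defensive.

Local Open Scope ring_scope.
Local Open Scope classical_set_scope.

(* The complex numbers: R[i] over the classical reals, with its usual
   (norm / metric) topology. *)
Notation CC := (Rdefinitions.R)[i].
HB.instance Definition _ := PseudoPointedMetric.copy CC CC^o.

(* A torsion-free abelian group. *)
Definition torsion_free (A : zmodType) : Prop :=
  forall (a : A) (n : nat), (0 < n)%N -> a *+ n = 0 -> a = 0.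

(* act is a (left) action of the group G on A by group automorphisms. *)
Definition action_by_automorphisms (G : groupType) (A : zmodType)
  (act : G -> A -> A) : Prop :=
  [/\ (forall g a b, act g (a + b) = act g a + act g b),
      (forall a, act 1%g a = a)
    & (forall g h a, act (g * h)%g a = act g (act h a))].

(* Every G-orbit in A is finite. *)
Definition finite_orbits (G : groupType) (A : zmodType) (act : G -> A -> A) :=
  forall a : A, finite_set [set act g a | g in [set: G]].

(* Pontryagin dual: Hom(A, S^1), with the topology of pointwise convergence
   (subspace topology of the product topology on A -> CC). *)
Definition dual_set (A : zmodType) : set (prod_topology (fun _ : A => CC)) :=
  [set chi | (forall a b, chi (a + b) = chi a * chi b) /\
             (forall a, `|chi a| = 1)].
Arguments dual_set : clear implicits.
Definition dual (A : zmodType) : topologicalType := set_type (dual_set A).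

(* The n-torus T^n = (S^1)^n with the product topology. *)
Definition torus (n : nat) : topologicalType :=
  set_type [set z : {ptws 'I_n -> CC} | forall i, `|z i| = 1].

(* The C*-algebra C(X) of continuous complex functions on X (as a set of
   functions). *)
Definition Cfun (X : topologicalType) : set (X -> CC) :=
  [set f | continuous f].
Arguments Cfun : clear implicits.

(* The fixed point algebra C(\hat A)^G for the induced action
   (g f)(chi) = f(chi o act g), i.e. f (chi o act g) = f chi for all g, chi. *)
Definition fixed_point_algebra (G : groupType) (A : zmodType)
  (act : G -> A -> A) : set (dual A -> CC) :=
  [set f | continuous f /\
     forall (g : G) (chi psi : dual A),
       (forall a, set_val psi a = set_val chi (act g a)) -> f psi = f chi].

(* *-isomorphism between two unital *-subalgebras of function algebras:
   a bijection preserving sums, products, complex scalar multiples,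
   involution (pointwise complex conjugation) and the unit. *)
Definition star_isomorphic (X Y : Type) (P : set (X -> CC)) (Q : set (Y -> CC))
  : Prop :=
  exists Phi : (X -> CC) -> (Y -> CC),
    set_bij P Q Phi /\
    (forall f g, P f -> P g ->
       Phi (fun x => f x + g x) = (fun y => Phi f y + Phi g y)) /\
    (forall f g, P f -> P g ->
       Phi (fun x => f x * g x) = (fun y => Phi f y * Phi g y)) /\
    (forall (c : CC) f, P f -> Phi (fun x => c * f x) = (fun y => c * Phi f y)) /\
    (forall f, P f -> Phi (fun x => (f x)^*) = (fun y => (Phi f y)^*)) /\
    Phi (fun _ => 1) = (fun _ => 1).

(* Main.v *)
(* Gelfand duality turns the isomorphism into a [G]-invariant continuous map [q] from the
   dual of [A] to the torus such that the fixed point algebra is exactly the set of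
   functions [f \o q].  Since every continuous map from the dual to the circle is a
   character [a] times the exponential of a real function (this is where torsion-freeness
   enters), the coordinates of [q] are [a_i * exp (i h_i)]; the [a_i] are then [G]-fixed and
   independent.  For homomorphisms [lam_j : A -> R] dual to the [a_i], the composite
   [R^n -> dual A -> torus] is covered by [y |-> y + h (y)] with [h] bounded, hence has dense
   image by a Brouwer-type argument.  So every invariant function is determined on the
   characters [exp (i sum y_j lam_j)].  The [lam_j] may be chosen constant on a given orbit;
   then the sum of that orbit has constant modulus, which is its cardinal, and the orbit is
   a point.  Finally each element of [A] is an invariant function [f \o q], and lifting [f]
   on the torus expresses it through the [a_i]. *)

(* [A] need not be finitely generated, so its dual has no finite system of coordinates. Compactness
   is the way around: up to a small error a continuous function depends on finitely many elements of
   [A], these lie in a subgroup with a basis, and the function can be pulled back to some [R^m],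
   where angles are summed along segments. Homomorphisms to [RR] extend because [RR] is divisible;
   the one-parameter subgroups they give stand in for connectedness of the dual.

   One criterion recurs: if [ev b] is the exponential of a continuous real function, then [b = 0]
   ([ev_bounded]). The criterion and the lifting theorem also apply to [Z^n], whose dual is the
   torus.

   Dense image suffices in the Brouwer-type step, since only continuous functions are compared
   there; hence no limit is taken and a mod 2 count of simplices is enough.

   Points of the circle that are [1 / 2]-close in both coordinates differ by an angle below
   [pi / 4]. A few such angles sum to less than [2 * pi], which turns congruences modulo [2 * pi]
   into equalities. *)
Require Import Defs.
From HB Require Import structures.
From mathcomp Require Import all_boot all_order all_algebra.
From mathcomp Require Import monoid.
From mathcomp Require Import all_classical all_reals all_analysis.
From mathcomp Require Import complex.
From mathcomp Require Import Rstruct Rstruct_topology.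
From mathcomp Require Import fingroup perm zmodp.
From mathcomp Require Import trigo.
From mathcomp Require Import zify ring lra.
Import Order.TTheory GRing.Theory Num.Theory.
Import numFieldTopology.Exports numFieldNormedType.Exports.
Local Open Scope ring_scope.
Local Open Scope classical_set_scope.
Set Implicit Arguments.
Unset Strict Implicit.

(** * Kuhn's lemma *)

Section CubicalCochains.
Local Open Scope ring_scope.
Variable R : comNzRingType.
Hypothesis R2 : forall x : R, x + x = 0.

(** The factors [b] are exchanged for [a] one at a time; in characteristic two the difference of
    consecutive hybrids is their sum. *)
Lemma prod_telescope (a b : nat -> R) (m n : nat) : (m <= n)%N ->
  \prod_(m <= i < n) b i +
  \sum_(m <= k < n)
    (\prod_(m <= i < k) a i * (a k + b k) * \prod_(k.+1 <= i < n) b i)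
  = \prod_(m <= i < n) a i.
Proof.
elim: n => [|n IH]; first by rewrite leqn0 => /eqP ->; rewrite !big_geq // addr0.
rewrite leq_eqVlt => /predU1P [->|]; first by rewrite !big_geq // addr0.
rewrite ltnS => mn; rewrite !(big_nat_recr n m) //= (@big_geq _ _ _ n.+1 n.+1) // mulr1.
rewrite [X in _ + (X + _)](eq_big_nat _ _ (F2 := fun k => \prod_(m <= i < k) a i *
   (a k + b k) * \prod_(k.+1 <= i < n) b i * b n)); last first.
  by move=> k /andP [_ kn] /=; rewrite big_nat_recr //= mulrA.
rewrite -mulr_suml addrA -mulrDl IH //.
by rewrite -mulrDr addrCA R2 addr0.
Qed.

Lemma prod_nat_pick (F : nat -> R) (m k n : nat) : (m <= k < n)%N ->
  \prod_(m <= i < n) F i =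
  \prod_(m <= i < k) F i * F k * \prod_(k.+1 <= i < n) F i.
Proof.
move=> /andP [mk kn]; rewrite (big_cat_nat mk (ltnW kn)) /= (big_ltn kn).
exact: mulrA.
Qed.

Variables (T : Type) (f : nat -> T -> R).

(** The simplicial face operator: vertex [k] of the path is dropped. *)
Definition face (k : nat) (w : nat -> T) : nat -> T :=
  fun i => w (if (i < k)%N then i else i.+1).

(* The cup product [df_0 ... df_(j-1) f_j df_(j+1) ... df_(n-1)]. *)
Definition cup (n j : nat) (w : nat -> T) : R :=
  \prod_(0 <= i < j) (f i (w i.+1) + f i (w i)) * f j (w j) *
  \prod_(j.+1 <= i < n) (f i (w i) + f i (w i.-1)).

(* Leibniz rule: [df_0 ... df_(n-1)] is the coboundary of [cup n j]. *)
Lemma cup_coboundary (n j : nat) (w : nat -> T) : (j < n)%N ->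
  \prod_(0 <= i < n) (f i (w i.+1) + f i (w i)) =
  \sum_(0 <= k < n.+1) cup n j (face k w).
Proof.
move=> jn.
pose a i := f i (w i.+1) + f i (w i).
have merge (x y z : R) : x + z = (y + z) + (x + y).
  by rewrite addrC [x + y]addrC addrACA R2 add0r.
(* Dropping a vertex up to [j] affects only the factors before [j] and moves [f j] to the vertex
   [j.+1]; dropping a later one affects only the factors after [j]. *)
have lo k : (k <= j)%N -> cup n j (face k w) =
    \prod_(0 <= i < j) (f i (face k w i.+1) + f i (face k w i)) * (f j (w j.+1) *
    \prod_(j.+1 <= i < n) a i).
  move=> kj; rewrite /cup -mulrA; congr (_ * (_ * _)).
    by rewrite /face ltnNge kj.
  apply: eq_big_nat => -[//|i] /andP [ji _].
  by rewrite /face /a !ltnNge /= (leq_trans kj) ?(leq_trans kj) // ltnW.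
have hi k : (j < k)%N -> cup n j (face k w) =
    \prod_(0 <= i < j) a i * f j (w j) *
    \prod_(j.+1 <= i < n) (f i (face k w i) + f i (face k w i.-1)).
  move=> jk; rewrite /cup; congr (_ * _ * _).
    apply: eq_big_nat => i /andP [_ ij].
    by rewrite /face /a (leq_ltn_trans ij jk) (ltn_trans ij jk).
  by rewrite /face jk.
rewrite [RHS](big_cat_nat (leq0n j.+1) (leqW jn)) /=.
rewrite [X in _ = X + _](eq_big_nat _ _ (F2 := fun k => \prod_(0 <= i < j) (f i (face k w i.+1) +
  f i (face k w i)) * (f j (w j.+1) * \prod_(j.+1 <= i < n) a i))); last first.
  by move=> k /andP [_ kj]; exact: lo.
rewrite -mulr_suml.
(* In face [k] the factors below [k.-1] are [a], those from [k] on are the shifted [b], and the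
   dropped vertex merges two differences into [a + b]: these are the terms of [prod_telescope]. *)
have -> : \sum_(0 <= k < j.+1) \prod_(0 <= i < j) (f i (face k w i.+1) +
    f i (face k w i)) = \prod_(0 <= i < j) a i.
  pose b i := f i (w i.+2) + f i (w i.+1).
  rewrite -(@prod_telescope a b 0 j) // big_nat_recl //; congr (_ + _).
  apply: eq_big_nat => k /andP [_ kj].
  rewrite (@prod_nat_pick _ 0 k) //; congr (_ * _ * _).
  - apply: eq_big_nat => i /andP [_ ik]; rewrite /face /a ltnS ik.
    by rewrite ltnS (ltnW ik).
  - by rewrite /face ltnn ltnSn; exact: merge.
  - apply: eq_big_nat => i /andP [ki _]; rewrite /face /b.
    have nki : (i < k.+1)%N = false by rewrite ltnNge ki.
    have nki' : (i.+1 < k.+1)%N = false by rewrite ltnNge leqW.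
    by rewrite nki nki'.
rewrite mulrA [X in _ + X](eq_big_nat _ _ (F2 := fun k => \prod_(0 <= i < j) a i *
  f j (w j) * \prod_(j.+1 <= i < n) (f i (face k w i) + f i (face k w i.-1)))); last first.
  by move=> k /andP [kj _]; exact: hi.
rewrite -mulr_sumr.
pose b i := f i (w i) + f i (w i.-1).
have -> : \sum_(j.+1 <= k < n.+1) \prod_(j.+1 <= i < n)
    (f i (face k w i) + f i (face k w i.-1)) = \prod_(j.+1 <= i < n) a i.
  have := @prod_telescope b a j.+1 n jn; rewrite big_nat_recr //=.
  set S := \sum_(_ <= _ < _) _; set S' := \sum_(_ <= _ < _) _ => E.
  have -> : S' = S.
    apply: eq_big_nat => k /andP [jk kn].
    rewrite (@prod_nat_pick _ j.+1 k) ?jk //; congr (_ * _ * _).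
    - apply: eq_big_nat => i /andP [ji ik]; rewrite /face /b ik.
      by rewrite (leq_ltn_trans (leq_pred i) ik).
    - rewrite /face ltnn; case: k jk kn => // k jk kn /=.
      by rewrite ltnSn /b /=; exact: merge.
    - apply: eq_big_nat => -[//|i] /andP [ki _]; rewrite /face /a.
      have nki : (i < k)%N = false by rewrite ltnNge -ltnS ki.
      have nki' : (i.+1 < k)%N = false by rewrite ltnNge ltnW.
      by rewrite nki nki' /=.
  have -> : \prod_(j.+1 <= i < n) (f i (face n w i) + f i (face n w i.-1)) =
      \prod_(j.+1 <= i < n) b i.
    apply: eq_big_nat => i /andP [_ ik]; rewrite /face ik.
    by rewrite (leq_ltn_trans (leq_pred i) ik).
  by rewrite -E addrCA R2 addr0.
rewrite -mulrDl -mulrDr; exact: (@prod_nat_pick a 0 j n).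
Qed.
End CubicalCochains.

(** * Freudenthal triangulation of the cube *)

Section KuhnPaths.
Variables (n p : nat).
Implicit Types (x : {ffun 'I_n -> 'I_p}) (t : 'S_n).

(* The monotone path of the Freudenthal simplex at [x] : coordinate [c] is
   incremented at time [t c]. *)
Definition kpath x t (k : nat) : 'I_n -> nat := fun c => (x c + (t c < k))%N.

(** Every interior face belongs to exactly two simplices and cancels mod 2. Faces with [0 < k < n]
    are shared inside one small cube, faces [0] and [n] by neighbouring small cubes; what is left
    lies on the boundary of the big cube, where [H] vanishes. *)
Lemma sum_faces_eq0 (R : comNzRingType) (H : (nat -> 'I_n -> nat) -> R) :
  (0 < n)%N -> (forall r : R, r + r = 0) ->
  (forall w w', (forall i, (i < n)%N -> w i = w' i) -> H w = H w') ->
  (forall w c, (forall i, (i < n)%N -> w i c = 0%N) -> H w = 0) ->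
  (forall w c, (forall i, (i < n)%N -> w i c = p) -> H w = 0) ->
  \sum_t \sum_x \sum_(0 <= k < n.+1) H (face k (kpath x t)) = 0.
Proof.
move=> n0 R2 Hext H0 Hp.
have mid k : (0 < k < n)%N -> \sum_t \sum_x H (face k (kpath x t)) = 0.
  move=> /andP [k0 kn]; have k1n : (k.-1 < n)%N by rewrite (leq_ltn_trans (leq_pred k)).
  (* Exchanging the times [k.-1] and [k] changes only vertex [k], the dropped one. The transposition
     is odd, so it matches odd permutations with even ones. *)
  pose s := tperm (Ordinal k1n) (Ordinal kn).
  have odd_s : odd_perm s.
    by rewrite odd_tperm -val_eqE /= neq_ltn prednK // leqnn.
  rewrite (bigID (fun t : 'S_n => odd_perm t)) /=.
  rewrite (reindex_inj (mulIg s)) /=.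
  rewrite [X in X + _](eq_big (fun t : 'S_n => ~~ odd_perm t)
    (fun t => \sum_x H (face k (kpath x t)))) ?R2 // => t.
    by rewrite odd_permM odd_s addbT.
  move=> _; apply: eq_bigr => x _; apply: Hext => i _.
  apply/funext => c; rewrite /face /kpath permM; congr (_ + nat_of_bool _)%N.
  set j := if _ then _ else _.
  have jk : j != k by rewrite /j; case: ltngtP; lia.
  rewrite /s; case: tpermP => [->|->|//] /=; lia.
pose r := perm (@ord_pred_inj n).
have ends : \sum_t \sum_x H (face 0 (kpath x t)) =
            \sum_t \sum_x H (face n (kpath x t)).
  rewrite [RHS](reindex_inj (mulIg r)); apply: eq_bigr => t _ /=.
  (* Face [0] of a simplex is face [n] of the one in the next cube along the first direction
     travelled. The cyclic [ordS] makes this a bijection; when it wraps around, one face lies at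
     level [p] and the other at level [0], and both terms vanish. *)
  pose sh x := [ffun c => if val (t c) == 0%N then ordS (x c) else x c].
  have sh_inj : injective sh.
    move=> x y /ffunP xy; apply/ffunP => c; have := xy c; rewrite !ffunE.
    by case: ifP => // _ /ordS_inj.
  rewrite [RHS](reindex_inj sh_inj); apply: eq_bigr => x _ /=.
  pose c0 := (t^-1)%g (Ordinal n0).
  have tc0 : t c0 = Ordinal n0 by rewrite /c0 permKV.
  have rE c : val ((t * r)%g c) = ((t c + n).-1 %% n)%N by rewrite permM permE.
  have trn c : t c = Ordinal n0 -> val ((t * r)%g c) = n.-1.
    by move=> tc; rewrite rE tc /= add0n modn_small ?prednK.
  have trp c : t c != Ordinal n0 -> val ((t * r)%g c) = (t c).-1.
    move=> tc; have tc1 : (0 < t c)%N by rewrite lt0n; move: tc; rewrite -val_eqE.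
    rewrite rE -subn1 -addnBAC // modnDr modn_small ?subn1 //.
    by rewrite (leq_ltn_trans (leq_pred _)).
  have [xp|xp] := boolP ((x c0).+1 < p)%N.
    apply: Hext => i ltin; apply/funext => c; rewrite /face /kpath ltin ltn0 ffunE.
    have [tc|tc] := eqVneq (t c) (Ordinal n0).
      have -> : c = c0 by rewrite -(permK t c) tc.
      rewrite trn // tc0 /= modn_small //.
      have -> : (n.-1 < i)%N = false by lia.
      by rewrite /= addn0 addn1.
    rewrite trp //; have -> : (val (t c) == 0)%N = false by move: tc; rewrite -val_eqE => /negbTE.
    have tc1 : (0 < t c)%N by rewrite lt0n; move: tc; rewrite -val_eqE.
    by congr (_ + nat_of_bool _)%N; lia.
  have {}xp : (x c0).+1 = p by have := ltn_ord (x c0); lia.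
  rewrite (Hp _ c0) => [|i ltin]; last by rewrite /face /kpath ltn0 tc0 /= addn1.
  rewrite (H0 _ c0) // => i ltin; rewrite /face /kpath ltin ffunE tc0 eqxx /=.
  by rewrite xp modnn trn // (_ : (n.-1 < i)%N = false) //; lia.
under eq_bigr do rewrite exchange_big /=.
rewrite exchange_big /= big_ltn // big_nat_recr //= [X in _ + (X + _)]big1_seq ?add0r.
  by rewrite ends R2.
by move=> k /andP [_]; rewrite mem_index_iota => /mid.
Qed.

End KuhnPaths.

Section KuhnLemma.
Variables (n q : nat).
Local Notation p := q.+1.
Local Notation F2 := 'F_2.

Lemma F2_addxx (x : F2) : x + x = 0.
Proof. by rewrite -mulr2n -mulr_natl pchar_Fp_0 ?mul0r. Qed.

Definition face_labels (i : 'I_n) (g : ('I_n -> nat) -> F2) :=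
  (forall y, y i = 0%N -> g y = 0) /\ (forall y, y i = p -> g y = 1).

(** The cochain [df_0 ... df_(n-1)] integrated mod 2 over the triangulated cube of side [p]. *)
Definition kuhn_sum (f : nat -> ('I_n -> nat) -> F2) : F2 :=
  \sum_(t : 'S_n) \sum_(x : {ffun 'I_n -> 'I_p})
    \prod_(0 <= i < n) (f i (kpath x t i.+1) + f i (kpath x t i)).

(** Stokes: the integrand is the coboundary of [cup n j], so only the boundary of the cube
    counts. *)
Lemma kuhn_sum_vanish (f : nat -> ('I_n -> nat) -> F2) (j : 'I_n) :
  (forall y, y j = 0%N \/ y j = p -> f j y = 0) ->
  (forall i : 'I_n, i != j -> face_labels i (f i)) -> kuhn_sum f = 0.
Proof.
move=> fj fi; rewrite /kuhn_sum.
under eq_bigr do under eq_bigr do rewrite (cup_coboundary F2_addxx _ _ (ltn_ord j)).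
have n0 : (0 < n)%N by rewrite (leq_ltn_trans _ (ltn_ord j)).
(* On a face of direction [c] the factor of [cup] indexed by [c] vanishes. *)
have cup0 w (c : 'I_n) (m : nat) (e : F2) :
    (forall i, (i < n)%N -> w i c = m) -> (c = j -> forall y, y j = m -> f j y = 0) ->
    (c != j -> forall y, y c = m -> f c y = e) -> cup f n j w = 0.
  move=> wm hj hc; rewrite /cup; have [cj|cj] := eqVneq c j.
    by rewrite (hj cj (w j)) ?mulr0 ?mul0r // -cj wm.
  have hcw i : (i < n)%N -> f c (w i) = e by move=> ltin; rewrite hc ?wm.
  have [ltcj|ltjc|/val_inj cj'] := ltngtP c j; last by rewrite cj' eqxx in cj.
  - rewrite (@prod_nat_pick _ _ 0 c) // !hcw ?F2_addxx ?mulr0 ?mul0r //.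
    exact: leq_ltn_trans ltcj (ltn_ord j).
  - rewrite [X in _ * X](@prod_nat_pick _ _ j.+1 c) ?ltjc ?ltn_ord // !hcw ?F2_addxx ?mulr0 ?mul0r ?mulr0 //.
    exact: leq_ltn_trans (leq_pred _) (ltn_ord c).
apply: sum_faces_eq0 => //.
- exact: F2_addxx.
- move=> w w' ww'; rewrite /cup (ww' j) //; congr (_ * _ * _); apply: eq_big_nat => i.
    move=> /andP [_ ij]; rewrite !ww' //; last exact: leq_ltn_trans ij (ltn_ord j).
    exact: ltn_trans ij (ltn_ord j).
  move=> /andP [_ ltin]; rewrite !ww' //; exact: leq_ltn_trans (leq_pred _) ltin.
- move=> w c wc; apply: (cup0 w c 0%N 0) => // [_ y yj|cj]; first by apply: fj; left.
  by have [] := fi c cj.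
- move=> w c wc; apply: (cup0 w c p 1) => // [_ y yj|cj]; first by apply: fj; right.
  by have [] := fi c cj.
Qed.

Definition coord_label (i : nat) (y : 'I_n -> nat) : F2 :=
  if insub i is Some c then (y c == p)%:R else 0.

Lemma coord_labelE (c : 'I_n) y : coord_label c y = (y c == p)%:R.
Proof. by rewrite /coord_label valK. Qed.

(** A product is nonzero only if every coordinate [c] reaches [p] exactly at step [c]. This singles
    out the identity permutation in the last corner cube. *)
Lemma kuhn_sum_coord : kuhn_sum coord_label = 1.
Proof.
rewrite /kuhn_sum (bigD1 1%g) //= (bigD1 [ffun=> ord_max]) //=.
have fac t (x : {ffun 'I_n -> 'I_p}) (c : 'I_n) :
    coord_label c (kpath x t c.+1) + coord_label c (kpath x t c) =
    ((t c == c) && (x c == ord_max))%:R.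
  rewrite !coord_labelE /kpath -!val_eqE /=.
  have := ltn_ord (x c); have [tc|tc|tc] := ltngtP (t c) c.
  - by rewrite [(t c < c.+1)%N]ltnS (ltnW tc) F2_addxx.
  - have -> : (t c < c.+1)%N = false by rewrite ltnS leqNgt tc.
    by rewrite F2_addxx.
  - move=> xp; rewrite tc leqnn addn0 addn1 (_ : (val (x c) == p)%N = false).
      by rewrite addr0 eqSS.
    by apply/negbTE; rewrite neq_ltn xp.
have prodE t (x : {ffun 'I_n -> 'I_p}) : \prod_(0 <= i < n)
    (coord_label i (kpath x t i.+1) + coord_label i (kpath x t i)) =
    ((t == 1%g) && (x == [ffun=> ord_max]))%:R.
  rewrite big_mkord (eq_bigr _ (fun c _ => fac t x c)).
  have [/andP [/eqP -> /eqP ->]|ne] := boolP (_ && _).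
    by rewrite big1 // => c _; rewrite perm1 ffunE !eqxx.
  have [c hc] : exists c, ~~ ((t c == c) && (x c == ord_max)).
    apply/existsP; rewrite -negb_forall; apply: contra ne => /forallP h.
    apply/andP; split; apply/eqP.
      by apply/permP => c; rewrite perm1; have /andP [/eqP] := h c.
    by apply/ffunP => c; rewrite ffunE; have /andP [_ /eqP] := h c.
  by rewrite (bigD1 c) //= (negbTE hc) mul0r.
rewrite prodE !eqxx [X in _ + X + _]big1 ?addr0 => [|x xne].
  rewrite big1 ?addr0 // => t tne; rewrite big1 // => x _.
  by rewrite prodE (negbTE tne).
by rewrite prodE (negbTE xne) andbF.
Qed.

(** The labels are replaced by the coordinate labels one at a time. The sum is additive in each
    label, and the difference of two admissible labels vanishes on both of its faces, so
    [kuhn_sum_vanish] applies to it. *)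
Lemma kuhn_sum_labels (f : nat -> ('I_n -> nat) -> F2) :
  (forall i : 'I_n, face_labels i (f i)) -> kuhn_sum f = 1.
Proof.
move=> ff; pose g s i := if (i < s)%N then coord_label i else f i.
have gg s (i : 'I_n) : face_labels i (g s i).
  rewrite /g; case: ifP => // _; split=> y yi; rewrite coord_labelE yi ?eqxx //.
suff gs s : (s <= n)%N -> kuhn_sum (g s) = kuhn_sum f.
  rewrite -(gs n) // -kuhn_sum_coord /kuhn_sum.
  apply: eq_bigr => t _; apply: eq_bigr => x _; apply: eq_big_nat => i /andP [_ ltin].
  by rewrite /g ltin.
elim: s => [//|s IH] ltsn; rewrite -{}IH ?(ltnW ltsn) //.
pose h i y := if i == s then g s.+1 i y + g s i y else g s i y.
have : kuhn_sum h = 0.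
  apply: (@kuhn_sum_vanish _ (Ordinal ltsn)) => [y|i].
    rewrite /h eqxx; have [g0 g1] := gg s (Ordinal ltsn).
    by have [g0' g1'] := gg s.+1 (Ordinal ltsn); case=> ys /=;
      [move: (g0 _ ys) (g0' _ ys)|move: (g1 _ ys) (g1' _ ys)] => /= -> ->; rewrite F2_addxx.
  by rewrite -val_eqE /= => /negbTE ne; rewrite /h /face_labels ne; exact: gg.
have hE : kuhn_sum h = kuhn_sum (g s.+1) + kuhn_sum (g s).
  rewrite /kuhn_sum -big_split; apply: eq_bigr => t _ /=.
  rewrite -big_split; apply: eq_bigr => x _ /=.
  have gS i y : i != s -> g s.+1 i y = g s i y.
    by move=> ne; rewrite /g ltnS leq_eqVlt (negbTE ne).
  have pick F : (forall i y, i != s -> F i y = g s i y) ->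
      \prod_(0 <= i < n) (F i (kpath x t i.+1) + F i (kpath x t i)) =
      \prod_(0 <= i < s) (g s i (kpath x t i.+1) + g s i (kpath x t i)) *
      (F s (kpath x t s.+1) + F s (kpath x t s)) *
      \prod_(s.+1 <= i < n) (g s i (kpath x t i.+1) + g s i (kpath x t i)).
    move=> Fg; rewrite (@prod_nat_pick _ _ 0 s n) //.
    congr (_ * _ * _); apply: eq_big_nat => i /andP [a b];
      have ne : i != s by lia.
    - by rewrite !Fg.
    - by rewrite !Fg.
  rewrite (pick h) => [|i y ne]; last by rewrite /h (negbTE ne).
  rewrite (pick (g s.+1)) // (pick (g s)) // -mulrDl -mulrDr; congr (_ * _ * _).
  by rewrite /h eqxx addrACA.
rewrite hE => /eqP; rewrite addr_eq0 => /eqP ->.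
by apply/esym/eqP; rewrite -addr_eq0 F2_addxx.
Qed.

(* Kuhn's cubical form of Sperner's lemma. *)
Lemma kuhn (f : 'I_n -> ('I_n -> nat) -> bool) :
  (forall i y, y i = 0%N -> f i y = false) ->
  (forall i y, y i = p -> f i y = true) ->
  exists (x : 'I_n -> nat) (y z : 'I_n -> 'I_n -> nat),
    (forall i c, (x c <= y i c <= (x c).+1)%N /\ (x c <= z i c <= (x c).+1)%N) /\
    (forall i, f i (y i) != f i (z i)).
Proof.
move=> f0 fp.
pose F i y : F2 := if insub i is Some c then (f c y)%:R else 0.
have FE (c : 'I_n) y : F c y = (f c y)%:R by rewrite /F valK.
have K : kuhn_sum F = 1.
  apply: kuhn_sum_labels => c; split=> y yc; rewrite FE.
    by rewrite (f0 _ _ yc).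
  by rewrite (fp _ _ yc).
have [[t x] /= tx] : exists tx : 'S_n * {ffun 'I_n -> 'I_p},
    \prod_(0 <= i < n) (F i (kpath tx.2 tx.1 i.+1) + F i (kpath tx.2 tx.1 i)) != 0.
  apply/existsP; apply: contra_eqT K; rewrite negb_exists => /forallP K.
  rewrite /kuhn_sum big1 1?eq_sym ?oner_neq0 // => t _; rewrite big1 // => x _.
  by apply/eqP; have := K (t, x); rewrite negbK.
exists (fun c => x c), (fun i => kpath x t i.+1), (fun i => kpath x t i); split.
  by move=> i c; rewrite /kpath; do 2!case: (_ < _)%N; lia.
move=> c; apply: contraNneq tx => fc.
by rewrite big_mkord (bigD1 c) //= !FE fc F2_addxx mul0r.
Qed.

End KuhnLemma.

(** * Complex numbers and the exponential of the circle *)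

Definition RR : realType := Rdefinitions.R.
Definition re (z : CC) : RR := complex.Re z.
Definition im (z : CC) : RR := complex.Im z.

Lemma nbhs_complexP (z : CC) (V : set CC) :
  nbhs z V <-> exists2 e : RR, 0 < e &
    forall w, `|re w - re z| < e -> `|im w - im z| < e -> V w.
Proof.
split.
- move=> /(@nbhs_ballP CC CC) [[e e'] /=].
  rewrite ltcE /= => /andP[/eqP ->{e'} e0] eV.
  exists (e / 2); first by rewrite divr_gt0.
  move=> [c d] /= h1 h2; apply: eV; rewrite /ball /=.
  case: z h1 h2 => a b /= h1 h2; rewrite normc_def ltcR /=.
  rewrite -[ltRHS](ger0_norm (ltW e0)) -sqrtr_sqr ltr_sqrt ?exprn_gt0 //.
  rewrite -(real_normK (num_real (a - c))) -(real_normK (num_real (b - d))).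
  rewrite distrC in h1; rewrite distrC in h2.
  have := normr_ge0 (a - c); have := normr_ge0 (b - d); nra.
- move=> [e e0 eV]; apply/(@nbhs_ballP CC CC); exists (e%:C)%C => /=.
    by rewrite /= ltcR.
  move=> [c d]; rewrite /ball /= normc_def ltcR /=.
  case: z eV => a b /= eV h.
  have lt_norm (x y : RR) : Num.sqrt (x ^+ 2 + y ^+ 2) < e -> `|x| < e.
    apply: le_lt_trans; rewrite -sqrtr_sqr ler_sqrt ?addr_ge0 ?sqr_ge0 //.
    by rewrite lerDl sqr_ge0.
  apply: eV; rewrite /= distrC; first exact: lt_norm h.
  by apply: (lt_norm _ (a - c)); rewrite addrC.
Qed.

Lemma cvg_complexP (T : Type) (F : set_system T) (u : T -> CC) (z : CC) :
  Filter F -> u @ F --> z <->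
    (re \o u) @ F --> re z /\ (im \o u) @ F --> im z.
Proof.
move=> FF; split=> [uz|[rz iz] V /nbhs_complexP [e e0 eV]].
  split; apply/cvgrPdist_lt => e e0.
    by apply: (uz [set w | `|re z - re w| < e]); apply/nbhs_complexP; exists e;
      rewrite // => w h1 h2; rewrite /= distrC.
  by apply: (uz [set w | `|im z - im w| < e]); apply/nbhs_complexP; exists e;
    rewrite // => w h1 h2; rewrite /= distrC.
move/cvgrPdist_lt/(_ _ e0): rz => rz; move/cvgrPdist_lt/(_ _ e0): iz => iz.
by apply: filterS2 rz iz => t /= h1 h2; apply: eV; rewrite distrC.
Qed.

Section ComplexFunctions.
Variable X : topologicalType.
Implicit Types u v : X -> CC.

Lemma continuous_complexP u :
  continuous u <-> continuous (re \o u) /\ continuous (im \o u).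
Proof.
split=> [uc|[rc ic] x]; last by apply/cvg_complexP; split; [exact: rc|exact: ic].
by split=> x; have /cvg_complexP [] := uc x.
Qed.

Lemma re_mul (z w : CC) : re (z * w) = re z * re w - im z * im w.
Proof. by case: z; case: w. Qed.

Lemma im_mul (z w : CC) : im (z * w) = re z * im w + im z * re w.
Proof. by case: z; case: w. Qed.

Lemma re_add (z w : CC) : re (z + w) = re z + re w.
Proof. by case: z; case: w. Qed.

Lemma im_add (z w : CC) : im (z + w) = im z + im w.
Proof. by case: z; case: w. Qed.

Lemma continuous_mulC u v : continuous u -> continuous v ->
  continuous (fun x => u x * v x).
Proof.
move=> /continuous_complexP [ru iu] /continuous_complexP [rv iv].
apply/continuous_complexP; split=> x.
  rewrite (_ : _ \o _ = fun x => re (u x) * re (v x) - im (u x) * im (v x)).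
    by apply: cvgB; apply: cvgM; [exact: ru|exact: rv|exact: iu|exact: iv].
  by apply/funext => y /=; rewrite re_mul.
rewrite (_ : _ \o _ = fun x => re (u x) * im (v x) + im (u x) * re (v x)).
  by apply: cvgD; apply: cvgM; [exact: ru|exact: iv|exact: iu|exact: rv].
by apply/funext => y /=; rewrite im_mul.
Qed.

Lemma continuous_addC u v : continuous u -> continuous v ->
  continuous (fun x => u x + v x).
Proof.
move=> /continuous_complexP [ru iu] /continuous_complexP [rv iv].
apply/continuous_complexP; split=> x.
  rewrite (_ : _ \o _ = fun x => re (u x) + re (v x)).
    by apply: cvgD; [exact: ru|exact: rv].
  by apply/funext => y /=; rewrite re_add.
rewrite (_ : _ \o _ = fun x => im (u x) + im (v x)).
  by apply: cvgD; [exact: iu|exact: iv].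
by apply/funext => y /=; rewrite im_add.
Qed.

Lemma continuous_conjC u : continuous u -> continuous (fun x => (u x)^*).
Proof.
move=> /continuous_complexP [ru iu]; apply/continuous_complexP; split=> x.
  rewrite (_ : _ \o _ = re \o u); first exact: ru.
  by apply/funext => y /=; case: (u y).
rewrite (_ : _ \o _ = fun x => - im (u x)); first by apply: cvgN; exact: iu.
by apply/funext => y /=; case: (u y).
Qed.

Lemma continuous_realC (h : X -> RR) : continuous h ->
  continuous (fun x => (h x)%:C%C : CC).
Proof.
by move=> hc; apply/continuous_complexP; split=> x; [exact: hc|exact: cvg_cst].
Qed.

Lemma continuous_sumC (I : Type) (r : seq I) (u : I -> X -> CC) :
  (forall i, continuous (u i)) -> continuous (fun x => \sum_(i <- r) u i x).
Proof.
move=> uc; elim: r => [|i r IH].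
  by under eq_fun do rewrite big_nil; move=> x; exact: cvg_cst.
by under eq_fun do rewrite big_cons; exact: continuous_addC.
Qed.

End ComplexFunctions.

Lemma normC1_sqr (z : CC) : `|z| = 1 -> re z ^+ 2 + im z ^+ 2 = 1.
Proof.
move=> z1; apply: (@complexI RR); rewrite add_Re2_Im2 z1 expr1n //.
Qed.

Definition expi (t : RR) : CC := (cos t +i* sin t)%C.

Lemma expi0 : expi 0 = 1.
Proof. by rewrite /expi cos0 sin0. Qed.

Lemma expiD s t : expi (s + t) = expi s * expi t.
Proof.
rewrite /expi cosD sinD /=; apply/eqP; rewrite eq_complex /=.
by rewrite eqxx /= addrC [sin s * _]mulrC [cos s * _]mulrC mulrC [cos t * sin s]mulrC eqxx.
Qed.

Lemma norm_expi t : `|expi t| = 1.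
Proof. by rewrite normc_def /= cos2Dsin2 sqrtr1. Qed.

Lemma expi_neq0 t : expi t != 0.
Proof. by rewrite -normr_gt0 norm_expi. Qed.

Lemma expiN t : expi (- t) = (expi t)^-1.
Proof.
by apply: (mulfI (expi_neq0 t)); rewrite -expiD subrr expi0 divff ?expi_neq0.
Qed.

Lemma expiB s t : expi (s - t) = expi s / expi t.
Proof. by rewrite expiD expiN. Qed.

Lemma expi_2pi : expi (2 * pi) = 1.
Proof. by rewrite mulr_natl /expi cos2pi sin2pi. Qed.

Lemma expi_int (k : int) : expi (2 * pi * k%:~R) = 1.
Proof.
have nat_case (n : nat) : expi (2 * pi * n%:R) = 1.
  elim: n => [|n IH]; first by rewrite mulr0 expi0.
  by rewrite -[n.+1%:R]natr1 mulrDr mulr1 expiD expi_2pi IH mulr1.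
case: k => n; first exact: nat_case.
by rewrite NegzE rmorphN mulrN expiN nat_case invr1.
Qed.

Lemma expi_eq1 t : expi t = 1 -> exists k : int, t = 2 * pi * k%:~R.
Proof.
move=> t1; exists (Num.floor (t / (2 * pi))).
set k := Num.floor _; pose s := t - 2 * pi * k%:~R.
have pi0 : 0 < (pi : RR) by exact: pi_gt0.
have s1 : expi s = 1 by rewrite expiB t1 expi_int divr1.
have s0 : 0 <= s.
  rewrite subr_ge0 mulrC -ler_pdivlMr ?mulr_gt0 //; exact: floor_le_tmp.
have s2 : s < 2 * pi.
  rewrite ltrBlDr (_ : 2 * pi + _ = (k + 1)%:~R * (2 * pi)); last first.
    by rewrite intrD; ring.
  by rewrite -ltr_pdivrMr ?mulr_gt0 //; exact: floorD1_gt.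
suff : s = 0 by move/eqP; rewrite subr_eq0 => /eqP.
have sin0' : sin (s / 2) = 0.
  have : cos s = 1 by case: s1.
  rewrite [s in cos s](_ : s = (s / 2) *+ 2); last by lra.
  rewrite cos_mulr2n => h; apply/eqP; rewrite -sqrf_eq0; apply/eqP.
  have := cos2Dsin2 (s / 2); lra.
case: (ltgtP 0 s) s0 => // sgt0 _.
have : 0 < sin (s / 2) by apply: sin_gt0_pi; apply/andP; split; lra.
by rewrite sin0' ltxx.
Qed.

Lemma expi_surj (z : CC) : `|z| = 1 -> exists2 t, `|t| <= pi & z = expi t.
Proof.
move=> /normC1_sqr; case: z => a b; rewrite /re /im /= => ab.
have a1 : -1 <= a <= 1 by apply/andP; split; nra.
have sa : sin (acos a) = `|b|.
  rewrite sin_acos // (_ : 1 - a ^+ 2 = b ^+ 2); last by lra.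
  by rewrite sqrtr_sqr.
have na : `|acos a| <= pi by rewrite ger0_norm ?acos_ge0 ?acos_lepi.
have [b0|b0] := leP 0 b.
  by exists (acos a); rewrite // /expi acosK ?in_itv //= sa ger0_norm.
exists (- acos a); first by rewrite normrN.
by rewrite /expi cosN sinN acosK ?in_itv //= sa ltr0_norm // opprK.
Qed.

Lemma continuous_expi (X : topologicalType) (h : X -> RR) :
  continuous h -> continuous (fun x => expi (h x)).
Proof.
move=> hc; apply/continuous_complexP; split=> x.
  by apply: (cvg_comp _ _ (hc x)); exact: continuous_cos.
by apply: (cvg_comp _ _ (hc x)); exact: continuous_sin.
Qed.

(* A branch of the argument, meaningful only on the open right half circle. *)
Definition arg (z : CC) : RR := asin (im z).

Lemma im_lt1 (z : CC) : `|z| = 1 -> 0 < re z -> -1 < im z < 1.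
Proof. by move=> /normC1_sqr; case: z => a b /= ab a0; apply/andP; split; nra. Qed.

Lemma expi_arg (z : CC) : `|z| = 1 -> 0 < re z -> expi (arg z) = z.
Proof.
move=> z1 rz; have /andP [l r] := im_lt1 z1 rz; move/normC1_sqr: z1.
rewrite /expi /arg; case: z rz l r => a b /= a0 l r ab.
rewrite asinK ?in_itv /= ?(ltW l) ?(ltW r) // cos_asin ?(ltW l) ?(ltW r) //.
by rewrite (_ : 1 - b ^+ 2 = a ^+ 2); [rewrite sqrtr_sqr gtr0_norm|lra].
Qed.

Lemma arg_lt (z : CC) : `|z| = 1 -> 0 < re z -> `|arg z| < pi / 2.
Proof.
move=> z1 rz; have lr := im_lt1 z1 rz.
by case/andP: lr => l r; rewrite ltr_norml asin_gtNpi2 ?asin_ltpi2 // ?l ?r ?(ltW l) ?(ltW r).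
Qed.

Lemma arg1 : arg 1 = 0.
Proof.
have := pi_gt0 RR; rewrite /arg -[im 1](@sin0 RR) => p0.
by rewrite sinK // in_itv /=; apply/andP; split; lra.
Qed.

Lemma cvg_arg (T : Type) (F : set_system T) (u : T -> CC) (z : CC) :
  Filter F -> `|z| = 1 -> 0 < re z -> u @ F --> z ->
  (fun t => arg (u t)) @ F --> arg z.
Proof.
move=> FF z1 rz /cvg_complexP [_ uz].
apply: (cvg_comp _ _ uz); exact/continuous_asin/im_lt1.
Qed.

(** The standard device for angle identities: check them after [expi], then bound the error. *)
Lemma expi_inj_lt s t : expi s = expi t -> `|s - t| < 2 * pi -> s = t.
Proof.
move=> st lt2; have [k kE] : exists k : int, s - t = 2 * pi * k%:~R.
  by apply: expi_eq1; rewrite expiB st divff ?expi_neq0.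
have pi0 : 0 < 2 * (pi : RR) by rewrite mulr_gt0 ?pi_gt0.
move: lt2; rewrite kE normrM (gtr0_norm pi0) gtr_pMr // -intr_norm ltrz1.
rewrite -[(_ < 1)%R]/(`|k| < 1)%R => k1.
have k0 : k = 0 by lia.
by apply/eqP; rewrite -subr_eq0 kE k0 mulr0.
Qed.

(** * Torsion-free groups *)

Section TorsionFree.
Variable A : zmodType.

Definition additive_map (B : zmodType) (l : A -> B) := forall a b, l (a + b) = l a + l b.

Definition comb (m : nat) (b : 'I_m -> A) (k : 'I_m -> int) : A := \sum_i b i *~ k i.

Definition independent (m : nat) (b : 'I_m -> A) :=
  forall k, comb b k = 0 -> forall i, k i = 0.

(* A graph of a partially defined additive map to [RR]. *)
Definition functional_subgroup (S : set (A * RR)) :=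
  [/\ S (0, 0), (forall x y, S x -> S y -> S (x.1 - y.1, x.2 - y.2))
    & forall r, S (0, r) -> r = 0].

Lemma functional_subgroup_bigcup (F : set (set (A * RR))) :
  F !=set0 -> F `<=` functional_subgroup -> total_on F subset ->
  functional_subgroup (\bigcup_(S in F) S).
Proof.
move=> [S0 FS0] FP tot; split.
- by exists S0 => //; have [] := FP _ FS0.
- move=> x y [S FS Sx] [S' FS' S'y].
  have [SS|SS] := tot _ _ FS FS'.
    by exists S' => //; have [_ s _] := FP _ FS'; apply: s => //; exact: SS.
  by exists S => //; have [_ s _] := FP _ FS; apply: s => //; exact: SS.
- by move=> r [S FS]; have [_ _] := FP _ FS; exact.
Qed.

Lemma torsion_freez (hA : torsion_free A) (a : A) (k : int) :
  k != 0 -> a *~ k = 0 -> a = 0.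
Proof.
case: k => n nz; first by move=> an; apply: (hA _ n) => //; rewrite lt0n.
by rewrite NegzE mulrNz => /eqP; rewrite oppr_eq0 => /eqP; exact: (hA _ n.+1).
Qed.

Lemma subgroup_mulz (S : set (A * RR)) : functional_subgroup S ->
  forall x (k : int), S x -> S (x.1 *~ k, x.2 *~ k).
Proof.
move=> [S0 Sb _] x k Sx.
have SN y : S y -> S (- y.1, - y.2).
  by move=> Sy; have := Sb _ _ S0 Sy; rewrite !sub0r.
have SD y z : S y -> S z -> S (y.1 + z.1, y.2 + z.2).
  by move=> Sy Sz; have := Sb _ _ Sy (SN _ Sz); rewrite /= !opprK.
have Sn n : S (x.1 *+ n, x.2 *+ n).
  elim: n => [//|n IH]; rewrite !mulrS; exact: (SD x (_, _)).
case: k => n; first exact: Sn.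
by rewrite NegzE !mulrNz; exact: (SN _ (Sn n.+1)).
Qed.

(* [RR] is divisible and torsion-free, hence injective among torsion-free groups. *)
Lemma extend_hom (hA : torsion_free A) (S : set (A * RR)) : functional_subgroup S ->
  exists2 l : A -> RR, additive_map l & forall x, S x -> l x.1 = x.2.
Proof.
move=> fS.
pose P (Q : set (A * RR)) := Q = set0 \/ functional_subgroup Q /\ S `<=` Q.
have [|Q [PQ maxQ]] := @Zorn_bigcup _ P.
  move=> F FP tot.
  have [F0|/existsNP [Q0 /not_implyP [FQ0 Q0ne]]] := pselect (forall Q, F Q -> Q = set0).
    by left; apply/seteqP; split => // x [Q /F0 ->].
  pose F' := [set Q | F Q /\ Q <> set0].
  have FE : \bigcup_(Q in F) Q = \bigcup_(Q in F') Q.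
    apply/seteqP; split=> x [Q]; last by move=> [FQ _] Qx; exists Q.
    by move=> FQ Qx; exists Q => //; split => // Q0'; rewrite Q0' in Qx.
  right; rewrite FE; split.
    apply: functional_subgroup_bigcup.
    - by exists Q0.
    - by move=> Q [/FP [] // []].
    - by move=> Q Q' [FQ _] [FQ' _]; exact: tot.
  by move=> x Sx; exists Q0 => //; have [//|[_]] := FP _ FQ0; exact.
have [fQ SQ] : functional_subgroup Q /\ S `<=` Q.
  case: PQ => // Q0; exfalso; apply: (maxQ S); last by right; split.
  rewrite Q0; split; first exact: sub0set.
  by move=> S0; have [/S0] := fS.
have [Q0 Qb Qf] := fQ.
have total a : exists r, Q (a, r).
  apply: contrapT => /forallNP na.
  (* The value at [a] is forced, by division, if some nonzero multiple of [a] is in the domain;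
     otherwise it is free, and [0] is taken. *)
  have [r hr] : exists r : RR, forall (k : int) s, Q (a *~ k, s) -> s = r *~ k.
    have [[n [s [n0 ns]]]|none] := pselect (exists n : int, exists s, n != 0 /\ Q (a *~ n, s)).
      have n0' : (n%:~R : RR) != 0 by rewrite intr_eq0.
      exists (s / n%:~R) => k s' ks.
      have h1 := subgroup_mulz fQ k ns; have h2 := subgroup_mulz fQ n ks.
      have := Qb _ _ h1 h2; rewrite /= -!mulrzA [k * n]mulrC subrr => /Qf /eqP.
      rewrite subr_eq0 => /eqP e; have {}e : s * k%:~R = s' * n%:~R by rewrite !mulrzr.
      by apply: (mulIf n0'); rewrite -e -[s / _ *~ k]mulrzr mulrAC divfK.
    exists 0 => k s ks; rewrite mul0rz.
    have k0 : k = 0.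
      by apply/eqP; apply: contrapT => /negP k0; apply: none; exists k, s.
    by move: ks; rewrite k0 mulr0z => /Qf.
  pose Q' := [set x | exists (y : A * RR) (k : int), Q y /\ x = (y.1 + a *~ k, y.2 + r *~ k)].
  have QQ' : Q `<=` Q'.
    by move=> x Qx; exists x, 0; split => //; rewrite !mulr0z !addr0; case: (x).
  apply: (maxQ Q').
    split => // Q'Q; apply: (na r); apply: Q'Q.
    by exists (0, 0), 1; split => //=; rewrite !add0r !mulr1z.
  right; split; last by move=> x /SQ /QQ'.
  split.
  - by exists (0, 0), 0; split => //; rewrite /= !mulr0z !addr0.
  - move=> _ _ [y [k [Qy ->]]] [y' [k' [Qy' ->]]].
    exists (y.1 - y'.1, y.2 - y'.2), (k - k'); split; first exact: Qb.
    by rewrite /= !mulrzBr; congr (_, _); rewrite opprD addrACA.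
  - move=> s [y [k [Qy [e1 e2]]]].
    have : Q (a *~ (- k), y.2).
      have -> : a *~ (- k) = y.1.
        by apply/eqP; rewrite mulrNz eq_sym -subr_eq0 opprK -e1.
      by case: (y) Qy.
    by move=> /hr yr; rewrite e2 yr mulrNz addNr.
pose l a := xget 0 [set r | Q (a, r)].
have lP a : Q (a, l a) by rewrite /l; case: xgetP => // /(_ _) h; have [r] := total a; move/h.
have luniq a r : Q (a, r) -> l a = r.
  move=> Qr; have := Qb _ _ (lP a) Qr; rewrite /= subrr => /Qf /eqP.
  by rewrite subr_eq0 => /eqP.
exists l; last by move=> [a r] /SQ /luniq.
move=> a b; apply: luniq.
have := Qb _ _ Q0 (lP b); rewrite /= !sub0r => QN.
by have := Qb _ _ (lP a) QN; rewrite /= !opprK.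
Qed.

Lemma additive0 (B : zmodType) (l : A -> B) : additive_map l -> l 0 = 0.
Proof. by move=> la; have := la 0 0; rewrite addr0 => /esym/eqP; rewrite -subr_eq0 addrK => /eqP. Qed.

Lemma additiveN (B : zmodType) (l : A -> B) : additive_map l -> forall a, l (- a) = - l a.
Proof.
by move=> la a; apply/eqP; rewrite -addr_eq0 -la addNr additive0.
Qed.

Lemma additiveMz (B : zmodType) (l : A -> B) : additive_map l ->
  forall a (k : int), l (a *~ k) = l a *~ k.
Proof.
move=> la a; have nat_case n : l (a *+ n) = l a *+ n.
  by elim: n => [|n IH]; rewrite ?mulr0n ?additive0 // !mulrS la IH.
case=> n; first exact: nat_case.
by rewrite NegzE !mulrNz additiveN // nat_case.
Qed.

Lemma additive_sum (B : zmodType) (l : A -> B) : additive_map l ->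
  forall (I : Type) (r : seq I) (F : I -> A), l (\sum_(i <- r) F i) = \sum_(i <- r) l (F i).
Proof.
by move=> la I r F; exact: (big_morph l la (additive0 la)).
Qed.

Lemma additive_comb (B : zmodType) (l : A -> B) : additive_map l ->
  forall m (b : 'I_m -> A) k, l (comb b k) = \sum_i l (b i) *~ k i.
Proof.
by move=> la m b k; rewrite /comb additive_sum //; apply: eq_bigr => i _; exact: additiveMz.
Qed.

Lemma combB m (b : 'I_m -> A) k k' : comb b k - comb b k' = comb b (fun i => k i - k' i).
Proof. by rewrite /comb -sumrB; apply: eq_bigr => i _; rewrite mulrzBr. Qed.

Lemma comb_delta m (b : 'I_m -> A) j : comb b (fun i => (i == j)%:R) = b j.
Proof.
rewrite /comb (bigD1 j) //= eqxx mulr1z big1 ?addr0 // => i /negbTE ->.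
by rewrite mulr0z.
Qed.

Lemma independent_hom (hA : torsion_free A) m (b : 'I_m -> A) (r : 'I_m -> RR) :
  independent b -> exists2 l : A -> RR, additive_map l & forall i, l (b i) = r i.
Proof.
move=> ib.
pose S := [set x : A * RR | exists k, x = (comb b k, \sum_i r i *~ k i)].
have [|l la lS] := @extend_hom hA S.
  split.
  - exists (fun=> 0); congr (_, _); first by rewrite /comb big1.
    by rewrite big1.
  - move=> _ _ [k ->] [k' ->]; exists (fun i => k i - k' i).
    rewrite /= combB; congr (_, _); rewrite -sumrB.
    by apply: eq_bigr => i _; rewrite mulrzBr.
  - move=> s [k [/esym/ib k0 ->]]; by rewrite big1 // => i _; rewrite k0.
exists l => // j; rewrite -[b j](comb_delta b j).
rewrite (lS (_, r j)) //=; exists (fun i => (i == j)%:R); congr (_, _).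
rewrite (bigD1 j) //= eqxx mulr1z big1 ?addr0 // => i /negbTE ->.
by rewrite mulr0z.
Qed.

Lemma separating_hom (hA : torsion_free A) (a : A) : a != 0 ->
  exists2 l : A -> RR, additive_map l & l a = 1.
Proof.
move=> a0; have [|l la l1] := @independent_hom hA 1 (fun=> a) (fun=> 1).
  move=> k; rewrite /comb big_ord1 => ak i; rewrite ord1.
  by apply/eqP; apply: contraNT a0 => /torsion_freez h; apply/eqP; exact: h.
by exists l => //; exact: (l1 ord0).
Qed.

End TorsionFree.

(** * Bases containing finitely many elements in their span *)

Section FiniteBasis.
Variable A : zmodType.
Hypothesis hA : torsion_free A.

Definition spanned m (b : 'I_m -> A) (a : A) := exists k, a = comb b k.

Lemma spannedD m (b : 'I_m -> A) x y : spanned b x -> spanned b y -> spanned b (x + y).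
Proof.
move=> [k ->] [l ->]; exists (fun i => k i + l i).
by rewrite /comb -big_split; apply: eq_bigr => i _; rewrite mulrzDr.
Qed.

Lemma spannedZ m (b : 'I_m -> A) x (n : int) : spanned b x -> spanned b (x *~ n).
Proof.
move=> [k ->]; exists (fun i => k i * n).
by rewrite /comb mulrz_suml; apply: eq_bigr => i _; rewrite mulrzA.
Qed.

Lemma spanned_mem m (b : 'I_m -> A) i : spanned b (b i).
Proof. by exists (fun j => (j == i)%:R); rewrite comb_delta. Qed.

Lemma spanned_trans m (b : 'I_m -> A) m' (c : 'I_m' -> A) x :
  spanned c x -> (forall i, spanned b (c i)) -> spanned b x.
Proof.
move=> [k ->] bc; rewrite /comb; elim/big_rec: _ => [|i y _ by_].
  by exists (fun=> 0); rewrite /comb big1.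
by apply: spannedD => //; apply: spannedZ.
Qed.

(* The Euclidean algorithm on the coefficients of a relation. *)
Lemma reduce_relation m (c : 'I_m.+1 -> A) (k : 'I_m.+1 -> int) i0 :
  comb c k = 0 -> k i0 != 0 ->
  exists c' : 'I_m -> A, forall i, spanned c' (c i).
Proof.
have [N] := ubnP (\sum_i `|k i|)%N; elim: N c k i0 => // N IH c k i0 ltN ck ki0.
(* If only one coefficient is nonzero, torsion-freeness kills the corresponding vector, which can be
   omitted. *)
have [/existsP [j1 /andP [j1i kj1]]|none] :=
    boolP [exists j, (j != i0) && (k j != 0)]; last first.
  have k0 j : j != i0 -> k j = 0.
    move=> ji; apply/eqP; apply: contraNT none => kj.
    by apply/existsP; exists j; rewrite ji.
  have ci0 : c i0 = 0.
    move: ck; rewrite /comb (bigD1 i0) //= big1 => [|j ji]; last by rewrite k0.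
    by rewrite addr0; exact: torsion_freez.
  exists (fun j => c (lift i0 j)) => i.
  have [->|ii0] := eqVneq i i0.
    by rewrite ci0; exists (fun=> 0); rewrite /comb big1.
  have i0i : i0 != i by rewrite eq_sym.
  by have [j -> _] := unlift_some i0i; exact: (spanned_mem (fun j => c (lift i0 j)) j).
have [i [j [ij ki kj le]]] : exists i j, [/\ i != j, k i != 0, k j != 0 & (`|k j| <= `|k i|)%N].
  have [le|le] := leqP `|k j1| `|k i0|.
    by exists i0, j1; rewrite eq_sym.
  by exists j1, i0; split => //; exact: ltnW.
have [e [e1 lt]] : exists e : int, e * e = 1 /\ (absz (k i - e * k j)%R < absz (k i))%N.
  have [s|s] := boolP ((0 <= k i) == (0 <= k j)).
    by exists 1; split => //; lia.
  by exists (-1); split => //; lia.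
(* An elementary operation on the vectors and its inverse on the coefficients: the relation
   persists, while the sum of the absolute values drops because of the sign [e]. *)
pose c' l := if l == j then c j + c i *~ e else c l.
pose k' l := if l == i then k i - e * k j else k l.
have c'i : c' i = c i by rewrite /c' (negbTE ij).
have c'j : c' j = c j + c i *~ e by rewrite /c' eqxx.
have k'i : k' i = k i - e * k j by rewrite /k' eqxx.
have k'j : k' j = k j by rewrite /k' eq_sym (negbTE ij).
have cc' l : spanned c' (c l).
  have [->|lj] := eqVneq l j.
    have -> : c j = c' j + c' i *~ (- e) by rewrite c'i c'j mulrNz addrK.
    by apply: spannedD; [|apply: spannedZ]; exact: spanned_mem.
  by have := spanned_mem c' l; rewrite {2}/c' (negbTE lj).
have c'k' : comb c' k' = 0.
  rewrite -ck /comb (bigD1 i) //= (bigD1 j) 1?eq_sym //= [RHS](bigD1 i) //=.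
  rewrite [in RHS](bigD1 j) 1?eq_sym //= c'i c'j k'i k'j !addrA; congr (_ + _).
    by rewrite mulrzBr mulrzDl -mulrzA addrA addrAC addrNK.
  by apply: eq_bigr => l /andP [li lj]; rewrite /c' /k' (negbTE li) (negbTE lj).
have ltN' : (\sum_l `|k' l| < N)%N.
  move: ltN; rewrite ltnS; apply: leq_trans.
  rewrite [ltnRHS](bigD1 i) //= (bigD1 i) //= k'i -addSn leq_add //.
  by apply: leq_sum => l /negbTE li; rewrite /k' li.
have k'0 : k' j != 0 by rewrite k'j.
have [b bc'] := IH c' k' j ltN' c'k' k'0.
by exists b => l; apply: spanned_trans (cc' l) bc'.
Qed.

(** Each relation allows a family with one vector fewer. Only the inclusion of the old span in the
    new one is tracked. *)
Lemma finite_basis m (c : 'I_m -> A) :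
  exists m' (b : 'I_m' -> A), independent b /\ forall i, spanned b (c i).
Proof.
elim: m c => [|m IH] c; first by exists 0%N, c; split=> [k _ []|[]].
have [ic|] := pselect (independent c).
  by exists m.+1, c; split => // i; exact: spanned_mem.
move=> /existsNP [k /not_implyP [ck /existsNP [i /eqP ki]]].
have [c' cc'] := reduce_relation ck ki.
have [m' [b [ib bc']]] := IH c'; exists m', b; split => // l.
exact: spanned_trans (cc' l) bc'.
Qed.

Lemma finite_basis_seq (s : seq A) :
  exists m (b : 'I_m -> A), independent b /\ forall a, a \in s -> spanned b a.
Proof.
have [m [b [ib bs]]] := finite_basis (fun i : 'I_(size s) => s`_i).
exists m, b; split => // a /(nthP 0) [i lti <-].
exact: (bs (Ordinal lti)).
Qed.

End FiniteBasis.

(** * Topology of the dual *)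

Section SubProduct.
Implicit Types d : RR.

Definition close d (z w : CC) := `|re z - re w| < d /\ `|im z - im w| < d.

Lemma close_sym d z w : close d z w -> close d w z.
Proof. by rewrite /close distrC [`|im z - _|]distrC. Qed.

Lemma close_trans d d' z w v : close d z w -> close d' w v -> close (d + d') z v.
Proof.
move=> [a b] [a' b']; split; [apply: le_lt_trans (ltrD a a')|apply: le_lt_trans (ltrD b b')];
  exact: ler_distD.
Qed.

Lemma closeW d d' z w : d <= d' -> close d z w -> close d' z w.
Proof. by move=> dd [a b]; split; [exact: lt_le_trans a _|exact: lt_le_trans b _]. Qed.

Lemma nbhs_close z d : 0 < d -> nbhs (z : CC) [set w | close d w z].
Proof. by move=> d0; apply/nbhs_complexP; exists d. Qed.

Variables (I : choiceType) (S : set (prod_topology (fun _ : I => CC))).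

(** The sets with the claimed property form a filter [F]. It converges to [x] because each
    coordinate does, so it contains every neighbourhood. *)
Lemma nbhs_subprodP (x : set_type S) (V : set (set_type S)) : nbhs x V ->
  exists (s : seq I) d, 0 < d /\ forall y : set_type S,
    (forall i : I, i \in s -> close d (set_val y i) (set_val x i)) -> V y.
Proof.
pose near_on (s : seq I) d (y : set_type S) := forall i : I, i \in s -> close d (set_val y i) (set_val x i).
pose F : set_system (set_type S) :=
  [set V | exists s d, 0 < d /\ forall y, near_on s d y -> V y].
have FF : Filter F.
  split.
  - by exists [::], 1.
  - move=> P Q [s [d [d0 P1]]] [s' [d' [d'0 Q1]]].
    exists (s ++ s'), (Num.min d d'); split; first by rewrite lt_min d0.
    move=> y yc; split; [apply: P1|apply: Q1] => a ai; apply: closeW (yc a _);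
      by rewrite ?ge_min ?lexx ?orbT // mem_cat ai ?orbT.
  - by move=> P Q PQ [s [d [d0 P1]]]; exists s, d; split => // y /P1 /PQ.
suff Fx : F --> x by exact: (Fx V).
have cv : (@set_val _ S) @ F --> (set_val x : prod_topology (fun _ : I => CC)).
  apply/cvg_sup => a U [_ [[W oW <-] /= Wx WU]].
  have /nbhs_complexP [e e0 eW] : nbhs (set_val x a : CC) W by exact: open_nbhs_nbhs.
  exists [:: a], e; split => // y yc; apply: WU => /=.
  by have [] := yc a (mem_head _ _); exact: eW.
move=> U [_ [[W oW <-] /= Wx WU]].
have /cv WF : nbhs (set_val x : prod_topology (fun _ : I => CC)) W.
  exact: open_nbhs_nbhs.
exact: filterS WU WF.
Qed.

Lemma continuous_coord (i : I) : continuous (fun x : set_type S => set_val x i : CC).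
Proof.
move=> x; apply: (@cvg_comp _ _ _ (@set_val _ S) (fun f => f i) _ (nbhs (set_val x))).
  exact: initial_continuous.
exact: (@proj_continuous _ (fun _ : I => CC) i).
Qed.

Lemma continuous_subprod_map (T : topologicalType) (g : T -> set_type S) :
  (forall i : I, continuous (fun t => set_val (g t) i : CC)) -> continuous g.
Proof.
move=> gc t V /nbhs_subprodP [s [d [d0 sV]]].
have : nbhs t [set t' | forall i, i \in s -> close d (set_val (g t') i) (set_val (g t) i)].
  elim: s {sV} => [|a s IH]; first by apply: filterS filterT => t' _ a; rewrite in_nil.
  have Na : nbhs t [set t' | close d (set_val (g t') a) (set_val (g t) a)].
    exact: (gc a t _ (nbhs_close (set_val (g t) a) d0)).
  by apply: filterS (filterI Na IH) => y [ya ys] b; rewrite inE => /predU1P [->//|]; exact: ys.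
by apply: filterS => t' /sV.
Qed.

End SubProduct.

Section DualTopology.
Variable A : zmodType.
Implicit Types (x y : dual A) (s : seq A) (d : RR).

Definition ev (a : A) (x : dual A) : CC := set_val x a.

Lemma evD a b x : ev (a + b) x = ev a x * ev b x.
Proof. by case: x => c hc; have [h _] := set_mem hc; exact: h. Qed.

Lemma norm_ev a x : `|ev a x| = 1.
Proof. by case: x => c hc; have [_ h] := set_mem hc; exact: h. Qed.

Lemma ev_neq0 a x : ev a x != 0.
Proof. by rewrite -normr_gt0 norm_ev. Qed.

Lemma ev0 x : ev 0 x = 1.
Proof. by apply: (mulfI (ev_neq0 0 x)); rewrite -evD addr0 mulr1. Qed.

Lemma dual_mk (c : A -> CC) : (forall a b, c (a + b) = c a * c b) ->
  (forall a, `|c a| = 1) -> exists x : dual A, forall a, ev a x = c a.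
Proof.
move=> cD c1; have hc : dual_set A c by split.
by exists (exist (fun f => f \in dual_set A) c (mem_set hc)).
Qed.

Lemma dual_ext x y : (forall a, ev a x = ev a y) -> x = y.
Proof. by move=> xy; apply: val_inj; apply/funext => a; exact: xy. Qed.

Lemma continuous_ev a : continuous (ev a).
Proof. exact: continuous_coord. Qed.

Definition close_on s d x y := forall a, a \in s -> close d (ev a x) (ev a y).

Lemma nbhs_close_on x s d : 0 < d -> nbhs x [set y | close_on s d y x].
Proof.
move=> d0; elim: s => [|a s IH].
  by apply: filterS (@filterT _ (nbhs x) _) => y _ a; rewrite in_nil.
have Na : nbhs x [set y | close d (ev a y) (ev a x)].
  exact: (@continuous_ev a x _ (nbhs_close (ev a x) d0)).
by apply: filterS (filterI Na IH) => y [ya ys] b; rewrite inE => /predU1P [->//|]; exact: ys.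
Qed.

Lemma nbhs_dualP x (V : set (dual A)) : nbhs x V ->
  exists s d, 0 < d /\ forall y, close_on s d y x -> V y.
Proof. exact: nbhs_subprodP. Qed.

Lemma continuous_dual (T : topologicalType) (g : T -> dual A) :
  (forall a, continuous (fun t => ev a (g t))) -> continuous g.
Proof. exact: continuous_subprod_map. Qed.

Lemma circle_compact : compact [set z : CC | `|z| = 1].
Proof.
have -> : [set z : CC | `|z| = 1] = expi @` `[- pi, pi].
  apply/seteqP; split => [z /expi_surj [t]|_ [t _ <-]]; last exact: norm_expi.
  by rewrite ler_norml => tp ->; exists t; rewrite //= in_itv.
apply: continuous_compact; last exact: segment_compact.
have ce : continuous (fun t : RR => expi t).
  by apply: (@continuous_expi RR (fun t => t)) => t; exact: cvg_id.
exact: continuous_subspaceT.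
Qed.

Lemma dual_set_compact : compact (dual_set A).
Proof.
have kc : @compact (prod_topology (fun _ : A => CC)) [set f | forall a, `|f a| = 1].
  exact: (tychonoff (fun _ : A => circle_compact)).
apply: subclosed_compact kc _; last by move=> f [].
pose pr (a : A) (f : prod_topology (fun _ : A => CC)) : CC := f a.
have prc a : continuous (pr a) by exact: (@proj_continuous _ (fun _ : A => CC) a).
have closed0 (h : prod_topology (fun _ : A => CC) -> RR) : continuous h ->
    closed [set f | h f = 0].
  move=> hc; have := @preimage_closed _ _ h [set r | r = 0] (fun f _ => hc f).
  by apply; exact: closed_eq.
pose u a b f := pr (a + b) f + (-1) * (pr a f * pr b f).
have uc a b : continuous (u a b).
  apply: continuous_addC; first exact: prc.
  by apply: continuous_mulC; [move=> ?; exact: cvg_cst|apply: continuous_mulC; exact: prc].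
pose v a f := (pr a f * (pr a f)^*) + (-1).
have vc a : continuous (v a).
  apply: continuous_addC; last by move=> ?; exact: cvg_cst.
  by apply: continuous_mulC; [exact: prc|apply: continuous_conjC; exact: prc].
have -> : dual_set A = \bigcap_(a : A) ([set f | re (v a f) = 0] `&` [set f | im (v a f) = 0])
    `&` \bigcap_(a : A) \bigcap_(b : A) ([set f | re (u a b f) = 0] `&` [set f | im (u a b f) = 0]).
  have c0 (z : CC) : re z = 0 -> im z = 0 -> z = 0 by case: z => p q; rewrite /re /im /= => -> ->.
  apply/seteqP; split => [f [fD f1]|f [h1 h2]].
    split=> [a _|a _ b _].
      by rewrite /v /pr /= -normCK f1 expr1n addrN.
    by rewrite /u /pr /= fD mulN1r addrN.
  split=> [a b|a].
    have [r i] := h2 a I b I; have /eqP := c0 _ r i.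
    by rewrite /u mulN1r subr_eq0 => /eqP.
  have [r i] := h1 a I; have /eqP := c0 _ r i.
  rewrite /v -normCK subr_eq0 -[X in _ == X](expr1n _ 2) eqrXn2 //.
  by move/eqP.
have closed_ri (w : prod_topology (fun _ : A => CC) -> CC) : continuous w ->
    closed ([set f | re (w f) = 0] `&` [set f | im (w f) = 0]).
  by move=> /continuous_complexP [rw iw]; apply: closedI; exact: closed0.
apply: closedI; first by apply: closed_bigI => a _; exact: closed_ri.
by apply: closed_bigI => a _; apply: closed_bigI => b _; exact: closed_ri.
Qed.

Lemma dual_compact : compact [set: dual A].
Proof.
move=> F PF _.
pose G : set_system (prod_topology (fun _ : A => CC)) := (@set_val _ (dual_set A)) @ F.
have SV (x : dual A) : dual_set A (set_val x) by case: x => c hc; exact: (set_mem hc).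
have GA : G (dual_set A).
  apply: (@filterS _ F _ setT); last exact: filterT.
  by move=> x _; exact: SV.
have [f [Af clf]] := dual_set_compact (fmap_proper_filter _ PF) GA.
exists (exist (fun f => f \in dual_set A) f (mem_set Af)); split => // U V FU [_ [[W oW <-] /= Wx WV]].
have GU : G (@set_val _ (dual_set A) @` U).
  by apply: (@filterS _ F _ U) => // x Ux; exists x.
have Wf : nbhs (f : prod_topology (fun _ : A => CC)) W.
  by apply: open_nbhs_nbhs; split => //; rewrite set_valE in Wx.
by have [_ [[x Ux <-] Wx']] := clf _ _ GU Wf; exists x; split => //; exact: WV.
Qed.

(** Uniform continuity on a compact space. It reduces questions about [u] to the finitely many
    elements [s] of [A]. *)
Lemma uniform_close (u : dual A -> CC) (e : RR) : continuous u -> 0 < e ->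
  exists s d, 0 < d /\ forall x y, close_on s d y x -> close e (u y) (u x).
Proof.
move=> uc e0.
(* The filter of ever larger finite sets and ever smaller tolerances; the near-covering form of
   compactness finds one pair that works at all points. *)
pose F : set_system (seq A * RR) := [set Q | exists s0 d0, 0 < d0 /\
  forall s d, {subset s0 <= s} -> 0 < d -> d <= d0 -> Q (s, d)].
have FF : Filter F.
  split.
  - by exists [::], 1.
  - move=> P Q [s [d [d0 P1]]] [s' [d' [d'0 Q1]]].
    exists (s ++ s'), (Num.min d d'); split; first by rewrite lt_min d0.
    move=> s1 d1 ss d1p; rewrite le_min => /andP [l l']; split; [apply: P1|apply: Q1] => // a ai;
      by apply: ss; rewrite mem_cat ai ?orbT.
  - by move=> P Q PQ [s [d [d0 P1]]]; exists s, d; split => // *; apply: PQ; exact: P1.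
pose P (i : seq A * RR) x := forall y, close_on i.1 i.2 y x -> close e (u y) (u x).
have e20 : 0 < e / 2 by rewrite divr_gt0.
have [|s0 [d0 [d0p H]]] := (compact_near_coveringP _).1 dual_compact _ F P FF.
  move=> x _; have /= /nbhs_dualP [s [d [dp sd]]] := uc x _ (nbhs_close (u x) e20).
  have d20 : 0 < d / 2 by rewrite divr_gt0.
  exists ([set y | close_on s (d / 2) y x], [set i : seq A * RR | {subset s <= i.1} /\ i.2 <= d / 2]) => /=.
    split; first exact: nbhs_close_on.
    by exists s, (d / 2); split.
  move=> [x' [s1 d1]] /= [xx' [ss1 dd1]] y yx'; rewrite [e]splitr.
  have ux' : close (e / 2) (u x') (u x) by apply: sd => a ai; apply: closeW (xx' a ai); lra.
  apply: close_trans (close_sym ux'); apply: sd => a ai; rewrite [d]splitr.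
  by apply: close_trans (xx' a ai); apply: closeW (yx' a (ss1 _ ai)).
exists s0, d0; split => // x y xy; exact: (H s0 d0).
Qed.

Lemma dual_bounded (h : dual A -> RR) : continuous h -> exists2 M, 0 < M & forall x, `|h x| <= M.
Proof.
move=> hc; have [x0 _] := @dual_mk (fun=> 1) (fun _ _ => esym (mulr1 1)) (fun=> normr1 _).
have [||c _ cM] := @compact_EVT_max _ RR (fun x => `|h x|) _ _ dual_compact.
- by exists x0.
- apply: continuous_subspaceT => x.
  exact: (cvg_norm (hc x)).
exists (`|h c| + 1); first by rewrite ltr_pwDr.
by move=> x; rewrite ler_wpDr // cM // in_setT.
Qed.
End DualTopology.

(** * Angles and real lifts *)

Lemma expi_pi : expi pi = -1.
Proof. by rewrite /expi cospi sinpi; apply/eqP; rewrite eq_complex /= oppr0 !eqxx. Qed.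

Lemma expi_uniform (d : RR) : 0 < d ->
  exists2 r : RR, 0 < r & forall x y, `|x - y| < r -> close d (expi x) (expi y).
Proof.
move=> d0; have d20 : 0 < d / 2 by rewrite divr_gt0.
have /cvgrPdist_lt /(_ _ d20) c0 := @continuous_cos RR 0.
have /cvgrPdist_lt /(_ _ d20) s0 := @continuous_sin RR 0.
have [r /= r0 hr] := (nbhs_ballP (0 : RR) _).1 (filterI c0 s0).
exists r => // x y xy; pose h := x - y.
have [] : `|cos 0 - cos h| < d / 2 /\ `|sin 0 - sin h| < d / 2.
  by apply: hr; rewrite /ball /= sub0r normrN.
rewrite cos0 sin0 sub0r normrN distrC => ch sh.
have cb (z w p q : RR) : `|z| <= 1 -> `|w| <= 1 -> `|p| < d / 2 -> `|q| < d / 2 -> `|z * p + w * q| < d.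
  move=> z1 w1 pd qd; rewrite (splitr d); apply: le_lt_trans (ler_normD _ _) _.
  by rewrite !normrM; apply: ltrD; [apply: le_lt_trans pd|apply: le_lt_trans qd]; rewrite ler_piMl.
have lc t : `|cos t| <= 1 by rewrite ler_norml cos_geN1 cos_le1.
have ls t : `|sin t| <= 1 by rewrite ler_norml sin_geN1 sin_le1.
have -> : x = y + h by rewrite /h addrC subrK.
clearbody h.
split; rewrite /expi /re /im /= ?cosD ?sinD.
  rewrite (_ : _ - _ = cos y * (cos h - 1) + (- sin y) * sin h); last by ring.
  by apply: cb; rewrite ?normrN.
rewrite (_ : _ - _ = sin y * (cos h - 1) + cos y * sin h); last by ring.
exact: cb.
Qed.

Lemma arg_lt_pi4 (z : CC) : `|z| = 1 -> 3 / 4 <= re z -> `|arg z| < pi / 4.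
Proof.
move=> z1 rz; have rz0 : 0 < re z by lra.
have := arg_lt z1 rz0; have := expi_arg z1 rz0; set t := arg z => zE t2.
have ct : 3 / 4 <= cos t by move: rz; rewrite -zE.
rewrite ltNge; apply/negP => t4.
(* Doubling: [cos (2 * t) > 0] and [|2 * t| < pi] force [|2 * t| < pi / 2]. *)
have : 0 < cos (`|t| *+ 2).
  rewrite cos_mulr2n; have -> : cos `|t| = cos t by case: ger0P; rewrite ?cosN.
  by rewrite expr2; nra.
have : 0 <= sin (`|t| *+ 2 - pi / 2).
  apply: sin_ge0_pi; apply/andP; split; lra.
by rewrite sinBpihalf; lra.
Qed.

Lemma norm_div1 (z w : CC) : `|z| = 1 -> `|w| = 1 -> `|z / w| = 1.
Proof. by move=> z1 w1; rewrite normrM normfV z1 w1 invr1 mulr1. Qed.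

(** On the circle [re (z / w) = 1 - |z - w|^2 / 2], and here [|z - w|^2 <= 1 / 2]. As [3 / 4]
    exceeds the cosine of [pi / 4], the angle stays below [pi / 4]. *)
Lemma close_ratio (z w : CC) : `|z| = 1 -> `|w| = 1 -> close (1 / 2) z w ->
  3 / 4 <= re (z / w).
Proof.
move=> z1 w1 [r i]; have -> : z / w = z * w^* .
  have w0 : w != 0 by rewrite -normr_gt0 w1.
  by apply: (mulIf w0); rewrite divfK // -mulrA [_^* * _]mulrC -normCK w1 expr1n mulr1.
move: (normC1_sqr z1) (normC1_sqr w1) r i.
case: z {z1} => a b; case: w {w1} => c d; rewrite /re /im /= => ab cd r i.
have {}r : (a - c) ^+ 2 <= 1 / 4 by rewrite -real_normK ?num_real //; have := normr_ge0 (a - c); nra.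
have {}i : (b - d) ^+ 2 <= 1 / 4 by rewrite -real_normK ?num_real //; have := normr_ge0 (b - d); nra.
nra.
Qed.

Definition angle (z w : CC) : RR := arg (z / w).

Lemma angleP (z w : CC) : `|z| = 1 -> `|w| = 1 -> close (1 / 2) z w ->
  expi (angle z w) = z / w /\ `|angle z w| < pi / 4.
Proof.
move=> z1 w1 zw; have r := close_ratio z1 w1 zw; have n := norm_div1 z1 w1.
by split; [apply: expi_arg => //; lra|exact: arg_lt_pi4].
Qed.

Lemma close_refl (d : RR) (z : CC) : 0 < d -> close d z z.
Proof. by move=> d0; rewrite /close !subrr normr0. Qed.

Section Angles.
Implicit Types z w : nat -> CC.

(** Both sides agree modulo [2 * pi], and four angles below [pi / 4] cannot make up a full turn. *)
Lemma angle_quad (z z' w w' : CC) : `|z| = 1 -> `|z'| = 1 -> `|w| = 1 -> `|w'| = 1 ->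
  close (1 / 2) z' z -> close (1 / 2) w' w -> close (1 / 2) w z -> close (1 / 2) w' z' ->
  angle w' w - angle z' z = angle w' z' - angle w z.
Proof.
move=> z1 z'1 w1 w'1 zz ww wz wz'.
have [e1 l1] := angleP w'1 w1 ww; have [e2 l2] := angleP z'1 z1 zz.
have [e3 l3] := angleP w'1 z'1 wz'; have [e4 l4] := angleP w1 z1 wz.
have nz (x : CC) : `|x| = 1 -> x != 0 by move=> x1; rewrite -normr_gt0 x1.
apply: expi_inj_lt.
  rewrite !expiB e1 e2 e3 e4 !invfM !invrK; field.
  by rewrite !nz.
have := pi_gt0 RR; move: l1 l2 l3 l4; rewrite !ltr_norml => *; lra.
Qed.

(** Discrete homotopy invariance: the squares between two nearby paths telescope, leaving the end
    angles. *)
Lemma angle_path z w K :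
  (forall i, `|z i| = 1) -> (forall i, `|w i| = 1) ->
  (forall i, (i < K)%N -> close (1 / 2) (z i.+1) (z i)) ->
  (forall i, (i < K)%N -> close (1 / 2) (w i.+1) (w i)) ->
  (forall i, (i <= K)%N -> close (1 / 2) (w i) (z i)) ->
  \sum_(i < K) angle (w i.+1) (w i) - \sum_(i < K) angle (z i.+1) (z i) =
  angle (w K) (z K) - angle (w 0%N) (z 0%N).
Proof.
move=> z1 w1 zz ww wz; rewrite -sumrB.
rewrite (eq_bigr (fun i : 'I_K => angle (w i.+1) (z i.+1) - angle (w i) (z i))); last first.
  move=> i _; apply: angle_quad => //; [exact: zz|exact: ww| |exact: wz].
  by apply: wz; exact: ltnW.
by rewrite -(big_mkord xpredT (fun i => angle (w i.+1) (z i.+1) - angle (w i) (z i)))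
  telescope_sumr.
Qed.

Lemma angle_inv (z w : CC) : `|z| = 1 -> `|w| = 1 -> close (1 / 2) z w ->
  angle z w = - angle w z.
Proof.
move=> z1 w1 zw; have [e1 l1] := angleP z1 w1 zw.
have [e2 l2] := angleP w1 z1 (close_sym zw).
apply: expi_inj_lt; first by rewrite expiN e1 e2 invf_div.
have := pi_gt0 RR; move: l1 l2; rewrite !ltr_norml => *; lra.
Qed.

Lemma angle_id (z : CC) : `|z| = 1 -> angle z z = 0.
Proof. by move=> z1; rewrite /angle divff ?arg1 // -normr_gt0 z1. Qed.

End Angles.

Section Lift.
Variables (m : nat) (f : ('I_m -> RR) -> CC) (r : RR).
Hypotheses (f1 : forall y, `|f y| = 1) (r0 : 0 < r).
Hypothesis fr : forall y y', (forall j, `|y j - y' j| < r) -> close (1 / 2) (f y) (f y').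

Let scale (t : RR) (y : 'I_m -> RR) := fun j => t * y j.
Let fine_mesh K (y : 'I_m -> RR) := forall j, `|y j| < r * K%:R.
(** The total angle swept by [f] along the segment from the origin to [y], in [K] steps. *)
Let theta K y := \sum_(i < K) angle (f (scale (i.+1%:R / K%:R) y)) (f (scale (i%:R / K%:R) y)).

Lemma fine_leq K K' y : (K <= K')%N -> fine_mesh K y -> fine_mesh K' y.
Proof.
move=> KK fK j; apply: lt_le_trans (fK j) _.
by rewrite ler_pM2l // ler_nat.
Qed.

Lemma fine_exists y : exists K, fine_mesh K.+1 y.
Proof.
pose M := \sum_j `|y j|; exists (Num.truncn (M / r)) => j.
have jM : `|y j| <= M by rewrite /M (bigD1 j) //= lerDl sumr_ge0.
apply: le_lt_trans jM _; rewrite mulrC -ltr_pdivrMr //.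
exact: truncnS_gt.
Qed.

Lemma scale_step K y i i' t t' : fine_mesh K y -> (0 < K)%N ->
  `|t - t'| <= K%:R^-1 -> i = scale t y -> i' = scale t' y -> close (1 / 2) (f i) (f i').
Proof.
move=> fK K0 tt -> ->; apply: fr => j; rewrite /scale -mulrBl normrM.
have K0' : 0 < (K%:R : RR) by rewrite ltr0n.
apply: le_lt_trans (ler_wpM2r (normr_ge0 _) tt) _.
by rewrite mulrC ltr_pdivrMr.
Qed.

Lemma frac_step (K i : nat) : (0 < K)%N -> `|i.+1%:R / K%:R - i%:R / K%:R : RR| <= K%:R^-1.
Proof.
by move=> K0; rewrite -mulrBl -[i.+1]addn1 natrD addrC addKr mul1r ger0_norm.
Qed.

(** No common refinement is needed: [i / K] and [i / (K + 1)] differ by at most [1 / K], so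
    [angle_path] compares the two subdivisions vertex by vertex, and the additional last step
    cancels the end angle. *)
Lemma thetaS K y : fine_mesh K y -> (0 < K)%N -> theta K.+1 y = theta K y.
Proof.
move=> fK K0; have K0' : 0 < (K%:R : RR) by rewrite ltr0n.
have fKS := fine_leq (leqnSn K) fK.
pose z i := f (scale (i%:R / K%:R) y); pose w i := f (scale (i%:R / K.+1%:R) y).
have wz i : (i <= K)%N -> close (1 / 2) (w i) (z i).
  move=> iK; apply: (scale_step fK K0 _ erefl erefl).
  have iK' : (i%:R : RR) <= K%:R by rewrite ler_nat.
  have i0 : 0 <= (i%:R : RR) by rewrite ler0n.
  have KS : (K.+1%:R : RR) = K%:R + 1 by rewrite -natr1.
  rewrite distrC KS (_ : _ - _ = i%:R / (K%:R + 1) * K%:R^-1); last first.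
    by field; rewrite ?gt_eqF //; lra.
  have K1 : 0 < (K%:R : RR) + 1 by lra.
  rewrite ger0_norm ?mulr_ge0 ?invr_ge0 ?ler0n // ?(ltW K1) //.
  by rewrite ler_piMl ?invr_ge0 ?ler0n // ler_pdivrMr //; lra.
have := @angle_path z w K (fun i => f1 _) (fun i => f1 _).
move=> /(_ _ _ wz) H.
have {}H : \sum_(i < K) angle (w i.+1) (w i) - \sum_(i < K) angle (z i.+1) (z i) =
  angle (w K) (z K) - angle (w 0%N) (z 0%N).
  apply: H => i iK.
    exact: (scale_step fK K0 (frac_step _ K0) erefl erefl).
  exact: (scale_step fKS _ (frac_step _ _) erefl erefl).
have w0z0 : w 0%N = z 0%N by rewrite /w /z !mul0r.
have zK : z K = w K.+1 by rewrite /w /z !divff // pnatr_eq0 // -lt0n.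
rewrite /theta big_ord_recr /= -/(w K.+1) -/(w K).
have -> : \sum_(i < K) angle (f (scale (i.+1%:R / K.+1%:R) y)) (f (scale (i%:R / K.+1%:R) y)) =
   \sum_(i < K) angle (z i.+1) (z i) + angle (w K) (z K).
  have a0 : angle (w 0%N) (z 0%N) = 0 by rewrite w0z0; exact: angle_id (f1 _).
  by move: H; rewrite a0 subr0 => <-; rewrite addrC subrK.
rewrite -addrA zK [angle (w K) _]angle_inv ?addNr ?addr0 ?f1 //.
by rewrite -zK; exact: wz.
Qed.

Lemma theta_leq K K' y : fine_mesh K.+1 y -> (K <= K')%N -> theta K'.+1 y = theta K.+1 y.
Proof.
move=> fK; elim: K' => [|K' IH]; first by rewrite leqn0 => /eqP ->.
rewrite leq_eqVlt => /predU1P [<-//|KK']; rewrite thetaS ?IH //.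
by apply: fine_leq fK.
Qed.

Lemma expi_theta K y : fine_mesh K y -> (0 < K)%N -> expi (theta K y) = f y / f (scale 0 y).
Proof.
move=> fK K0; have K0' : (K%:R : RR) != 0 by rewrite pnatr_eq0 -lt0n.
have nz x : f x != 0 by rewrite -normr_gt0 f1.
have part k : (k <= K)%N -> expi (\sum_(i < k) angle (f (scale (i.+1%:R / K%:R) y))
    (f (scale (i%:R / K%:R) y))) = f (scale (k%:R / K%:R) y) / f (scale 0 y).
  elim: k => [|k IH] kK; first by rewrite big_ord0 expi0 mul0r divff.
  rewrite big_ord_recr /= expiD IH ?(ltnW kK) //.
  have [-> _] := angleP (f1 _) (f1 _) (scale_step fK K0 (frac_step k K0) erefl erefl).
  by rewrite mulrC mulrA divfK.
rewrite part // divff // (_ : scale 1 y = y) //.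
by apply/funext => j; rewrite /scale mul1r.
Qed.

(** The lift is the swept angle plus a lift of the value at the origin. For nearby [y] and [y'] a
    common mesh makes the two segments comparable by [angle_path]. *)
Lemma lift_exists : exists th : ('I_m -> RR) -> RR,
  (forall y, expi (th y) = f y) /\
  (forall y y', (forall j, `|y' j - y j| < r) -> th y' - th y = angle (f y') (f y)).
Proof.
have [Kf KfP] := choice fine_exists.
have s0 y : scale 0 y = fun=> 0 by apply/funext => j; rewrite /scale mul0r.
have [t0 _ t0E] := expi_surj (f1 (fun=> 0)).
exists (fun y => theta (Kf y).+1 y + t0); split=> [y|y y' yy].
  by rewrite expiD expi_theta // s0 -t0E divfK // -normr_gt0 f1.
rewrite opprD addrACA subrr addr0.
pose K := maxn (Kf y) (Kf y').
rewrite -(theta_leq (KfP y) (leq_maxl _ (Kf y'))) -(theta_leq (KfP y') (leq_maxr (Kf y) _)) -/K.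
have fy : fine_mesh K.+1 y by apply: fine_leq (KfP y); rewrite ltnS leq_maxl.
have fy' : fine_mesh K.+1 y' by apply: fine_leq (KfP y'); rewrite ltnS leq_maxr.
pose z i := f (scale (i%:R / K.+1%:R) y); pose w i := f (scale (i%:R / K.+1%:R) y').
have -> : angle (f y') (f y) = angle (w K.+1) (z K.+1) - angle (w 0%N) (z 0%N).
  rewrite /w /z divff ?pnatr_eq0 // mul0r !s0 angle_id // subr0.
  have s1 x : scale 1 x = x by apply/funext => j; rewrite /scale mul1r.
  by rewrite !s1.
apply: (@angle_path z w K.+1) => [i|i|i iK|i iK|i iK]; rewrite ?f1 //.
- exact: (scale_step fy _ (frac_step _ _) erefl erefl).
- exact: (scale_step fy' _ (frac_step _ _) erefl erefl).
apply: fr => j; rewrite /scale -mulrBr normrM.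
apply: le_lt_trans (yy j); rewrite ler_piMl // ger0_norm ?divr_ge0 ?ler0n //.
by rewrite ler_pdivrMr ?ltr0n // mul1r ler_nat.
Qed.

End Lift.

(** * Characters, one-parameter subgroups and real exponents *)

Section Characters.
Variable A : zmodType.
Hypothesis hA : torsion_free A.

Lemma evMz a (k : int) (x : dual A) t : ev a x = expi t -> ev (a *~ k) x = expi (t *~ k).
Proof.
move=> at_; have nat_case n : ev (a *+ n) x = expi (t *+ n).
  elim: n => [|n IH]; first by rewrite !mulr0n ev0 expi0.
  by rewrite !mulrS evD expiD IH at_.
case: k => n; first exact: nat_case.
rewrite NegzE !mulrNz expiN -nat_case; apply: (mulIf (ev_neq0 (a *+ n.+1) x)).
by rewrite -evD addNr ev0 mulVf // ev_neq0.
Qed.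

Lemma ev_comb m (b : 'I_m -> A) k (x : dual A) y : (forall i, ev (b i) x = expi (y i)) ->
  ev (comb b k) x = expi (\sum_i y i *~ k i).
Proof.
move=> by_; rewrite /comb.
by elim/big_rec2: _ => [|i p q _ IH]; rewrite ?ev0 ?expi0 // evD expiD IH (evMz _ (by_ i)).
Qed.

Lemma exp_param m (lam : 'I_m -> A -> RR) : (forall j, additive_map (lam j)) ->
  exists e : ('I_m -> RR) -> dual A, forall y a, ev a (e y) = expi (\sum_j y j * lam j a).
Proof.
move=> lamD.
suff /choice [e eE] : forall y, exists x : dual A, forall a, ev a x = expi (\sum_j y j * lam j a).
  by exists e.
move=> y; apply: dual_mk => [a b|a]; last exact: norm_expi.
rewrite -expiD -big_split; congr expi; apply: eq_bigr => j _.
by rewrite lamD mulrDr.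
Qed.

Lemma exp_param_uniform m (lam : 'I_m -> A -> RR) (e : ('I_m -> RR) -> dual A) (s : seq A) d :
  (forall y a, ev a (e y) = expi (\sum_j y j * lam j a)) -> 0 < d ->
  exists2 r : RR, 0 < r & forall y y', (forall j, `|y j - y' j| < r) -> close_on s d (e y) (e y').
Proof.
move=> eE d0; have [r0 r0p h] := expi_uniform d0.
elim: s => [|a s [r rp IH]]; first by exists 1.
pose M := 1 + \sum_j `|lam j a|.
have M0 : 0 < M by rewrite ltr_pwDl // sumr_ge0.
exists (Num.min r (r0 / M)); first by rewrite lt_min rp divr_gt0.
move=> y y' yy b; rewrite inE => /predU1P [->|bs]; last first.
  by apply: IH bs => j; have := yy j; rewrite lt_min => /andP [].
rewrite !eE; apply: h; rewrite -sumrB.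
apply: (@le_lt_trans _ _ (\sum_j (r0 / M) * `|lam j a|)).
  apply: le_trans (ler_norm_sum _ _ _) _; apply: ler_sum => j _.
  rewrite -mulrBl normrM ler_wpM2r //.
  by have := yy j; rewrite lt_min => /andP [_ /ltW].
rewrite -mulr_sumr mulrAC ltr_pdivrMr // ltr_pM2l //.
by rewrite /M ltr_pwDl.
Qed.

(** Density of the one-parameter subgroups in the dual: [x] is matched on [s] by choosing arguments
    on a basis and extending them to a homomorphism. *)
Lemma ev_lift (x : dual A) (s : seq A) :
  exists2 l : A -> RR, additive_map l & forall a, a \in s -> ev a x = expi (l a).
Proof.
have [m [b [ib bs]]] := finite_basis_seq hA s.
have [y yE] : exists y : 'I_m -> RR, forall i, ev (b i) x = expi (y i).
  suff /choice [y yE] : forall i, exists t, ev (b i) x = expi t by exists y.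
  move=> i; by have [t _ tE] := expi_surj (norm_ev (b i) x); exists t.
have [l la lb] := independent_hom hA y ib.
exists l => // a /bs [k ->]; rewrite (ev_comb _ yE) additive_comb //.
by congr expi; apply: eq_bigr => i _; rewrite lb.
Qed.

Lemma expi_lift_const (g : RR -> RR) : continuous g -> (forall t, expi (g t) = 1) ->
  forall t, g t = g 0.
Proof.
move=> gc g1.
have seg a b : a <= b -> g a = g b.
  move=> ab; apply/eqP; apply: contraPT (g1 0) => nab; exfalso.
  have [k kE] : exists k : int, g b - g a = 2 * pi * k%:~R.
    by apply: expi_eq1; rewrite expiB !g1 divr1.
  have pi0 := pi_gt0 RR.
  have k0 : k != 0.
    by apply: contraNneq nab => k0; rewrite eq_sym -subr_eq0 kE k0 mulr0.
  (* The two values are at least [2 * pi] apart, so a value at distance [pi] from [g a] is attained;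
     its exponential would be [-1]. *)
  have [v [e [ve e1]]] : exists v e : RR, Num.min (g a) (g b) <= v <= Num.max (g a) (g b) /\
      (v = g a + e /\ expi e = -1).
    have kc : (1 : RR) <= k%:~R \/ k%:~R <= (-1 : RR).
      have [kp|kn] : (1 <= k \/ k <= -1)%R by lia.
        by left; rewrite -[1]/(1%:~R) ler_int.
      by right; rewrite -[-1]/((-1)%:~R) ler_int.
    case: kc => kc.
      exists (g a + pi), pi; split; last by rewrite expi_pi.
      rewrite ge_min le_max; apply/andP; split; apply/orP; [left|right]; nra.
    exists (g a - pi), (- pi); split; last by rewrite expiN expi_pi invrN1.
    rewrite ge_min le_max; apply/andP; split; apply/orP; [right|left]; nra.
  have [c _ gcv] := IVT ab (continuous_subspaceT gc) ve.
  have := g1 c; rewrite gcv (proj1 e1) expiD g1 (proj2 e1) mul1r => /eqP.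
  by rewrite eq_complex /= => /andP [/eqP]; lra.
move=> t; have [t0|t0] := leP 0 t; first by rewrite (seg _ _ t0).
by rewrite (seg _ _ (ltW t0)).
Qed.

Lemma exp_line (l : A -> RR) : additive_map l ->
  exists2 e : RR -> dual A, continuous e & forall t a, ev a (e t) = expi (t * l a).
Proof.
move=> la; suff /choice [e eE] : forall t, exists x : dual A, forall a, ev a x = expi (t * l a).
  exists e => //; apply: continuous_dual => a; under eq_fun do rewrite eE.
  by apply: continuous_expi => t; apply: cvgM; [exact: cvg_id|exact: cvg_cst].
move=> t; apply: dual_mk => [a c|a]; last exact: norm_expi.
by rewrite la mulrDr expiD.
Qed.

(* Along a one-parameter subgroup on which [b] has speed one, [t - w] is constant while
   [w] is bounded. *)
Lemma ev_bounded (w : dual A -> RR) b : continuous w -> (forall x, ev b x = expi (w x)) -> b = 0.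
Proof.
move=> wc bw; apply/eqP; apply: contraPT (wc) => b0 _.
have [l la lb] := separating_hom hA b0.
have [e ec eE] := exp_line la.
pose g t := t - w (e t).
have gc : continuous g.
  move=> t; apply: cvgB; first exact: cvg_id.
  by apply: (cvg_comp _ _ (ec t)); exact: wc.
have g1 t : expi (g t) = 1.
  by rewrite /g expiB -bw eE lb mulr1 divff // expi_neq0.
have [M M0 wM] := dual_bounded wc.
(* The time [2 * M + 1] exceeds the largest possible variation [2 * M] of [w]. *)
have := expi_lift_const gc g1 (2 * M + 1); rewrite /g sub0r => E.
have := wM (e (2 * M + 1)); have := wM (e 0); rewrite !ler_norml => /andP [p q] /andP [p' q'].
lra.
Qed.

End Characters.

(** Near [x] the increment of [h] agrees modulo [2 * pi] with an [arg] below [pi / 2]. The bound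
    [3 * pi / 2] is what makes them equal. *)
Lemma lift_continuous (X : topologicalType) (h : X -> RR) :
  continuous (fun x => expi (h x)) ->
  (forall x, \forall x' \near x, `|h x' - h x| < 3 * pi / 2) -> continuous h.
Proof.
move=> ec hb x; apply/cvgrPdist_lt => eps eps0.
pose v x' := expi (h x') * expi (- h x).
have vc : continuous v by apply: continuous_mulC => // t; exact: cvg_cst.
have vx : v x = 1 by rewrite /v -expiD subrr expi0.
have re1 : 0 < re 1 by rewrite /re /= ltr01.
have vn x' : `|v x'| = 1 by rewrite /v -expiD norm_expi.
have N1 : nbhs x [set x' | 0 < re (v x')].
  have Nv : nbhs x [set x' | close 1 (v x') (v x)] := vc x _ (nbhs_close (v x) ltr01).
  apply: filterS Nv => x' /= [] + _.
  by rewrite vx /re /= ltr_norml => /andP [l _]; lra.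
have N2 : nbhs x [set x' | `|arg (v x')| < eps].
  have /cvgrPdist_lt /(_ _ eps0) : (fun x' => arg (v x')) @ x --> arg (v x).
    by apply: cvg_arg; [rewrite vx normr1|rewrite vx|exact: vc].
  by move=> Nv; apply: filterS Nv => x'; rewrite vx arg1 sub0r normrN.
apply: filterS (filterI (hb x) (filterI N1 N2)) => x' [b1 [b2 b3]].
rewrite distrC; suff -> : h x' - h x = arg (v x') by [].
apply: expi_inj_lt; first by rewrite expi_arg // /v expiD.
have := arg_lt (vn x') b2; have := pi_gt0 RR.
by move: b1; rewrite !ltr_norml => /andP [p q] p0 /andP [p' q']; apply/andP; split; lra.
Qed.

(** * Unitary functions are characters times exponentials *)

Section UnitaryLift.
Variable A : zmodType.
Hypothesis hA : torsion_free A.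

(* [H^1(dual A; Z) = A]: up to a small error [u] only depends on the restriction of
   characters to a finitely generated subgroup, with basis [b].  Pulled back along
   [e : R^m -> dual A] it has a real lift [th], whose monodromy under [2 * pi * Z^m] is an
   integral linear form [k]; the character is [a = comb b k]. *)
Lemma unitary_lift (u : dual A -> CC) : continuous u -> (forall x, `|u x| = 1) ->
  exists a (h : dual A -> RR), continuous h /\ forall x, u x = ev a x * expi (h x).
Proof.
move=> uc u1.
have half0 : 0 < 1 / 2 :> RR by lra.
have pi0 := pi_gt0 RR.
have [s [d [d0 sd]]] := uniform_close uc half0.
have [m [b [ib bs]]] := finite_basis_seq hA s.
have [lam lamP] : exists lam : 'I_m -> A -> RR, forall j,
    additive_map (lam j) /\ forall i, lam j (b i) = (i == j)%:R.
  suff /choice [lam lamP] : forall j, exists l : A -> RR,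
      additive_map l /\ forall i, l (b i) = (i == j)%:R by exists lam.
  by move=> j; have [l la lb] := independent_hom hA (fun i => (i == j)%:R) ib; exists l.
have [e eE] := exp_param (fun j => (lamP j).1).
have eb y i : ev (b i) (e y) = expi (y i).
  rewrite eE (bigD1 i) //= (lamP i).2 eqxx mulr1 big1 ?addr0 // => j ji.
  by rewrite (lamP j).2 eq_sym (negbTE ji) mulr0.
(* [y] is a system of real coordinates of [x] on the basis. Then [x] and [e y] agree on the span of
   [b], which contains [s], though perhaps not on all of [A]. *)
pose valid x y := forall i, ev (b i) x = expi (y i).
have same x x' y : valid x y -> valid x' y -> close_on s d x' x.
  move=> xy x'y a /bs [k ->]; rewrite (ev_comb _ xy) (ev_comb _ x'y); exact: close_refl.
pose f y := u (e y).
have f1 y : `|f y| = 1 by exact: u1.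
have ufc x y : valid x y -> close (1 / 2) (u x) (f y).
  by move=> xy; apply: sd; apply: (same _ _ y) => // i; exact: eb.
have [r r0 er] := exp_param_uniform s eE d0.
have fr y y' : (forall j, `|y j - y' j| < r) -> close (1 / 2) (f y) (f y').
  by move=> yy; apply: sd; exact: er.
have [th [thE thP]] := lift_exists f1 r0 fr.
pose sh (l : 'rV[int]_m) (y : 'I_m -> RR) := fun j => y j + 2 * pi * (l 0 j)%:~R.
have fsh l y : close (1 / 2) (f (sh l y)) (f y).
  by apply: ufc => i; rewrite eb /sh expiD expi_int mulr1.
(* The monodromy of the lift. The angle corrects for [f] being only approximately periodic under
   [sh l], so that [D] takes values in [2 * pi * Z]. *)
pose D l y := th (sh l y) - th y - angle (f (sh l y)) (f y).
have D_local l y y' : (forall j, `|y' j - y j| < r) -> D l y' = D l y.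
  move=> yy; have yy' j : `|sh l y' j - sh l y j| < r by rewrite /sh opprD addrACA subrr addr0.
  have := angle_quad (f1 y) (f1 y') (f1 (sh l y)) (f1 (sh l y')) (fr _ _ yy) (fr _ _ yy')
    (fsh l y) (fsh l y').
  by rewrite -(thP _ _ yy) -(thP _ _ yy') /D; lra.
have D_const l y : D l y = D l (fun=> 0).
  have [K KP] : exists K : nat, forall j, `|y j| < r * K.+1%:R by exact: (fine_exists r0).
  have K0 : 0 < (K.+1%:R : RR) by rewrite ltr0n.
  have part i : D l (fun j => (i%:R / K.+1%:R) * y j) = D l (fun=> 0).
    elim: i => [|i <-]; first by congr D; apply/funext => j; rewrite !mul0r.
    apply: D_local => j; rewrite -mulrBl normrM.
    apply: le_lt_trans (ler_wpM2r (normr_ge0 _) (frac_step i (ltn0Sn K))) _.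
    by rewrite mulrC ltr_pdivrMr.
  rewrite -(part K.+1); congr D; apply/funext => j.
  by rewrite divff ?mul1r // gt_eqF.
have D_int l y : exists k : int, D l y = 2 * pi * k%:~R.
  apply: expi_eq1; rewrite /D !expiB !thE (angleP (f1 _) (f1 _) (fsh l y)).1.
  have nz x : f x != 0 by rewrite -normr_gt0 f1.
  by field; rewrite !nz.
have eq0_lt (t : RR) (k : int) : t = 2 * pi * k%:~R -> `|t| < 2 * pi -> t = 0.
  move=> tk lt; apply: expi_inj_lt; last by rewrite subr0.
  by rewrite tk expi_int expi0.
pose D0 l := D l (fun=> 0).
have D0D : additive_map D0.
  (* With [D l] read at [sh l' 0] instead of [0] all lifts cancel; three angles remain, too small
     for a nonzero multiple of [2 * pi]. *)
  move=> l l'; apply/eqP; rewrite -subr_eq0 opprD addrA; apply/eqP.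
  have [k1 e1] := D_int (l + l') (fun=> 0); have [k2 e2] := D_int l (fun=> 0).
  have [k3 e3] := D_int l' (fun=> 0).
  apply: (eq0_lt _ (k1 - k2 - k3)).
    by rewrite /D0 e1 e2 e3 !rmorphB /=; ring.
  rewrite /D0 -(D_const l (sh l' (fun=> 0))) /D.
  have -> : sh l (sh l' (fun=> 0)) = sh (l + l') (fun=> 0).
    by apply/funext => j; rewrite /sh mxE rmorphD /=; ring.
  have [_ l1] := angleP (f1 _) (f1 _) (fsh (l + l') (fun=> 0)).
  have [_ l2] := angleP (f1 _) (f1 _) (fsh l' (fun=> 0)).
  have := fsh l (sh l' (fun=> 0)).
  have -> : sh l (sh l' (fun=> 0)) = sh (l + l') (fun=> 0).
    by apply/funext => j; rewrite /sh mxE rmorphD /=; ring.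
  move=> /(angleP (f1 _) (f1 _)) [_ l3].
  by move: l1 l2 l3; rewrite !ltr_norml => /andP [? ?] /andP [? ?] /andP [? ?]; apply/andP; split; lra.
have [k kE] : exists k : 'I_m -> int, forall l, D0 l = \sum_j 2 * pi * (k j)%:~R * (l 0 j)%:~R.
  have /choice [k kE] : forall j, exists k : int, D0 (delta_mx 0 j) = 2 * pi * k%:~R.
    by move=> j; exact: D_int.
  exists k => l.
  have {1}-> : l = comb (fun j => delta_mx 0 j) (fun j => l 0 j).
    by rewrite {1}(row_sum_delta l); apply: eq_bigr => j _; rewrite -scaler_int intz.
  by rewrite additive_comb //; apply: eq_bigr => j _; rewrite kE -mulrzr.
pose a := comb b k; exists a.
have eva x y : valid x y -> ev a x = expi (\sum_j (k j)%:~R * y j).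
  move=> xy; rewrite (ev_comb _ xy); congr expi; apply: eq_bigr => j _.
  by rewrite -mulrzl.
have /choice [Y YP] : forall x, exists y, valid x y.
  move=> x; suff /choice [y yP] : forall i, exists t, ev (b i) x = expi t by exists y.
  by move=> i; have [t _ tE] := expi_surj (norm_ev (b i) x); exists t.
(* The lift minus its linear part, corrected because [u x] is only close to [f y]. *)
pose hh x y := th y - \sum_j (k j)%:~R * y j + angle (u x) (f y).
have expi_hh x y : valid x y -> expi (hh x y) = u x / ev a x.
  move=> xy; rewrite /hh expiD expiB thE (angleP (u1 x) (f1 y) (ufc _ _ xy)).1 -(eva _ _ xy).
  have nz : f y != 0 by rewrite -normr_gt0 f1.
  by field; rewrite nz ev_neq0.
have hh_indep x y y' : valid x y -> valid x y' -> hh x y' = hh x y.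
  move=> xy xy'; apply: expi_inj_lt; first by rewrite !expi_hh.
  have /choice [l lE] : forall j, exists l : int, y' j - y j = 2 * pi * l%:~R.
    by move=> j; apply: expi_eq1; rewrite expiB -xy -xy' divff // ev_neq0.
  pose L : 'rV[int]_m := \row_j l j.
  have y'E : y' = sh L y.
    by apply/funext => j; rewrite /sh mxE -lE addrC subrK.
  (* The monodromy equals the change of the linear form subtracted in [hh], so [hh] changes only by
     three small angles. *)
  have : D L y = \sum_j 2 * pi * (k j)%:~R * (L 0 j)%:~R by rewrite D_const -kE.
  have -> : \sum_j 2 * pi * (k j)%:~R * (L 0 j)%:~R =
      \sum_j (k j)%:~R * y' j - \sum_j (k j)%:~R * y j.
    rewrite -sumrB; apply: eq_bigr => j _; rewrite -mulrBr lE mxE; ring.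
  rewrite /D -y'E /hh => DE.
  have [_ l1] := angleP (u1 x) (f1 y) (ufc _ _ xy).
  have [_ l2] := angleP (u1 x) (f1 y') (ufc _ _ xy').
  have := fsh L y; rewrite -y'E => /(angleP (f1 _) (f1 _)) [_ l3].
  by move: l1 l2 l3; rewrite !ltr_norml => /andP [? ?] /andP [? ?] /andP [? ?]; apply/andP; split; lra.
exists (fun x => hh x (Y x)); split; last first.
  by move=> x; rewrite expi_hh // mulrC divfK // ev_neq0.
apply: lift_continuous => [|x].
  have cc : continuous (fun x => u x * ev (- a) x).
    by apply: continuous_mulC => //; exact: continuous_ev.
  suff -> : (fun x => expi (hh x (Y x))) = (fun x => u x * ev (- a) x) by exact: cc.
  apply/funext => x; rewrite expi_hh //; congr (_ * _); apply: (mulfI (ev_neq0 a x)).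
  by rewrite -evD subrr ev0 divff // ev_neq0.
pose M := 1 + \sum_j `|(k j)%:~R : RR|.
have M0 : 0 < M by rewrite /M ltr_pwDl // sumr_ge0.
(* Below [r] the lift [th] moves by a single angle; below [pi / 4 / M] the linear form moves by at
   most [pi / 4]. With the two correction angles the total stays under [3 * pi / 2]. *)
pose d1 := Num.min r (pi / 4 / M).
have d10 : 0 < d1 by rewrite lt_min r0 !divr_gt0.
have N j : nbhs x [set x' | close (1 / 2) (ev (b j) x') (ev (b j) x) /\
    `|angle (ev (b j) x') (ev (b j) x)| < d1].
  have c1 : nbhs x [set x' | close (1 / 2) (ev (b j) x') (ev (b j) x)].
    exact: (@continuous_ev _ (b j) x _ (nbhs_close _ half0)).
  apply: filterI => //.
  have /cvgrPdist_lt /(_ _ d10) : (fun x' => angle (ev (b j) x') (ev (b j) x)) @ x -->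
      arg (ev (b j) x / ev (b j) x).
    have re1 : 0 < re 1 by rewrite /re /= ltr01.
    have cc : continuous (fun x' => ev (b j) x' * (ev (b j) x)^-1).
      apply: continuous_mulC; first exact: continuous_ev.
      exact: cst_continuous.
    have e1 : ev (b j) x / ev (b j) x = 1 by rewrite divff // ev_neq0.
    by apply: cvg_arg (cc x); rewrite e1 ?normr1.
  by move=> Nv; apply: filterS Nv => x'; rewrite divff ?ev_neq0 // arg1 sub0r normrN.
pose close_to x' j := close (1 / 2) (ev (b j) x') (ev (b j) x) /\
  `|angle (ev (b j) x') (ev (b j) x)| < d1.
have FN : nbhs x [set x' | forall j, close_to x' j].
  have Fx : Filter (nbhs x) by exact: nbhs_filter.
  exact: filter_forall N.
apply: filterS FN => x' /= Nx'.
pose y' j := Y x j + angle (ev (b j) x') (ev (b j) x).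
have xy' : valid x' y'.
  move=> j; rewrite /y' expiD -(YP x j).
  rewrite (angleP (norm_ev _ _) (norm_ev _ _) (Nx' j).1).1.
  by rewrite mulrC divfK // ev_neq0.
rewrite (hh_indep x' y' (Y x')) // /hh.
have yy j : `|y' j - Y x j| < r.
  by rewrite /y' addrC addKr; have := (Nx' j).2; rewrite lt_min => /andP [].
have [_ l1] := angleP (f1 _) (f1 _) (fr _ _ yy).
have [_ l2] := angleP (u1 x) (f1 _) (ufc _ _ (YP x)).
have [_ l3] := angleP (u1 x') (f1 _) (ufc _ _ xy').
have l4 : `|\sum_j (k j)%:~R * y' j - \sum_j (k j)%:~R * Y x j| <= pi / 4.
  rewrite -sumrB; apply: le_trans (ler_norm_sum _ _ _) _.
  apply: (@le_trans _ _ (\sum_j `|(k j)%:~R| * (pi / 4 / M))).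
    apply: ler_sum => j _; rewrite -mulrBr normrM ler_wpM2l // /y' addrC addKr.
    by have := (Nx' j).2; rewrite lt_min => /andP [_ /ltW].
  rewrite -mulr_suml mulrCA ler_piMr ?divr_ge0 ?ler0n ?(ltW pi0) //.
  by rewrite ler_pdivrMr // mul1r /M lerDr.
move: l1 l2 l3 l4; rewrite -(thP _ _ yy) !ltr_norml ler_norml.
by move=> /andP [? ?] /andP [? ?] /andP [? ?] /andP [? ?]; apply/andP; split; lra.
Qed.

End UnitaryLift.

(** * Gelfand duality for the fixed point algebra *)

Section Torus.
Variable n : nat.
Implicit Types z w : torus n.

Definition coord (i : 'I_n) z : CC := set_val z i.

Lemma norm_coord i z : `|coord i z| = 1.
Proof. by case: z => c hc; exact: (set_mem hc). Qed.

Lemma torus_mk (c : 'I_n -> CC) : (forall i, `|c i| = 1) ->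
  exists z : torus n, forall i, coord i z = c i.
Proof.
move=> c1; have hc : [set z : {ptws 'I_n -> CC} | forall i, `|z i| = 1] c by [].
by exists (exist (fun f => f \in _) c (mem_set hc)).
Qed.

Lemma torus_ext z w : (forall i, coord i z = coord i w) -> z = w.
Proof. by move=> zw; apply: val_inj; apply/funext => i; exact: zw. Qed.

Lemma continuous_tcoord i : continuous (coord i).
Proof. exact: continuous_coord. Qed.

Lemma continuous_torus_map (T : topologicalType) (g : T -> torus n) :
  (forall i, continuous (fun t => coord i (g t))) -> continuous g.
Proof. exact: continuous_subprod_map. Qed.

Lemma nbhs_torusP z (V : set (torus n)) : nbhs z V ->
  exists2 d : RR, 0 < d & forall w, (forall i, close d (coord i w) (coord i z)) -> V w.
Proof.
move=> /nbhs_subprodP [s [d [d0 sV]]]; exists d => // w wz.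
by apply: sV => i _; exact: wz.
Qed.

End Torus.

Definition sqnorm (z : CC) : CC := z * z^*.

Lemma sqnormE (z : CC) : sqnorm z = ((re z ^+ 2 + im z ^+ 2)%:C)%C.
Proof. by rewrite /sqnorm -normCK -add_Re2_Im2. Qed.

Lemma sqnorm1 (z : CC) : sqnorm z = 1 <-> `|z| = 1.
Proof.
rewrite /sqnorm -normCK; split=> [/eqP|->]; last by rewrite expr1n.
by rewrite -[X in _ == X](expr1n _ 2) eqrXn2 // => /eqP.
Qed.

Section Gelfand.
Variables (G : groupType) (A : zmodType) (act : G -> A -> A) (n : nat).

Let P := fixed_point_algebra act.

Lemma fixed_cst c : P (fun=> c).
Proof. by split=> //; exact: cst_continuous. Qed.

Lemma fixed_add F F' : P F -> P F' -> P (fun x => F x + F' x).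
Proof.
move=> [cF iF] [cF' iF']; split; first exact: continuous_addC.
by move=> g x y xy; rewrite (iF g x y xy) (iF' g x y xy).
Qed.

Lemma fixed_mul F F' : P F -> P F' -> P (fun x => F x * F' x).
Proof.
move=> [cF iF] [cF' iF']; split; first exact: continuous_mulC.
by move=> g x y xy; rewrite (iF g x y xy) (iF' g x y xy).
Qed.

Lemma fixed_conj F : P F -> P (fun x => (F x)^*).
Proof.
move=> [cF iF]; split; first exact: continuous_conjC.
by move=> g x y xy; rewrite (iF g x y xy).
Qed.

Lemma fixed_sum (I : Type) (r : seq I) (F : I -> dual A -> CC) :
  (forall i, P (F i)) -> P (fun x => \sum_(i <- r) F i x).
Proof.
move=> PF; elim: r => [|i r IH].
  by under eq_fun do rewrite big_nil; exact: fixed_cst.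
by under eq_fun do rewrite big_cons; exact: fixed_add.
Qed.

Hypothesis hiso : star_isomorphic (fixed_point_algebra act) (Cfun (torus n)).

(* A character of [C(torus n)] is the evaluation at the point [z0] of its values on the
   coordinates: otherwise [|f - c|^2 + sum |z_i - z0_i|^2] would be an invertible element
   of its kernel. *)
Lemma gelfand : exists q : dual A -> torus n,
  [/\ (forall F, P F -> exists2 f : torus n -> CC, continuous f & F = f \o q),
      (forall f : torus n -> CC, continuous f -> P (f \o q))
    & (forall f f' : torus n -> CC, continuous f -> continuous f' -> f \o q = f' \o q -> f = f')].
Proof.
have [Phi [[PhiP PhiI PhiS] [PhiD [PhiM [PhiZ [PhiC Phi1]]]]]] := hiso.
have cst1 (c : CC) : Phi (fun=> c) = fun=> c.
  have := PhiZ c _ (fixed_cst 1); rewrite Phi1 => E.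
  have -> : (fun=> c) = (fun _ : dual A => c * 1) by apply/funext => x; rewrite mulr1.
  by rewrite E; apply/funext => z; rewrite mulr1.
have Phi_sum (I : Type) (r : seq I) (F : I -> dual A -> CC) : (forall i, P (F i)) ->
    Phi (fun x => \sum_(i <- r) F i x) = fun z => \sum_(i <- r) Phi (F i) z.
  move=> PF; elim: r => [|i r IH].
    under eq_fun do rewrite big_nil; rewrite cst1.
    by apply/funext => z; rewrite big_nil.
  have -> : (fun x => \sum_(j <- i :: r) F j x) = fun x => F i x + \sum_(j <- r) F j x.
    by apply/funext => x; rewrite big_cons.
  rewrite PhiD; [|exact: PF|exact: fixed_sum].
  by rewrite IH; apply/funext => z; rewrite big_cons.
have inj : forall E E', P E -> P E' -> Phi E = Phi E' -> E = E'.
  by move=> E E' PE PE'; apply: PhiI; exact: mem_set.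
have pre (f : torus n -> CC) : continuous f -> exists F, P F /\ Phi F = f.
  by move=> fc; have [E PE EE] := PhiS f fc; exists E.
have /choice [U UP] : forall i : 'I_n, exists F, P F /\ Phi F = coord i.
  by move=> i; apply: pre; exact: continuous_tcoord.
have U1 i x : `|U i x| = 1.
  have [PU UE] := UP i; apply/sqnorm1.
  have : (fun x => U i x * (U i x)^*) = fun=> 1.
    apply: inj; [by apply: fixed_mul => //; exact: fixed_conj|exact: fixed_cst|].
    rewrite PhiM //; last exact: fixed_conj.
    rewrite PhiC // UE Phi1; apply/funext => z.
    by apply/sqnorm1; exact: norm_coord.
  by move/(congr1 (fun f => f x)).
have /choice [q qP] : forall x, exists z : torus n, forall i, coord i z = U i x.
  by move=> x; exact: torus_mk.
have key F x : P F -> F x = Phi F (q x).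
  move=> PF; apply: contrapT => Fx.
  pose sq (F0 : dual A -> CC) (c : CC) := fun y => (F0 y + - c) * (F0 y + - c)^*.
  have Psq F0 c : P F0 -> P (sq F0 c) /\ Phi (sq F0 c) = fun z => sqnorm (Phi F0 z - c).
    move=> PF0; have PFc : P (fun y => F0 y + - c) by apply: fixed_add => //; exact: fixed_cst.
    have PFc' := fixed_conj PFc; split; first exact: fixed_mul.
    rewrite /sq PhiM // PhiC // PhiD //; last exact: fixed_cst.
    by rewrite cst1.
  pose S := fun y => \sum_(i < n) sq (U i) (U i x) y.
  have PS : P S by apply: fixed_sum => i; exact: (Psq _ _ (UP i).1).1.
  pose T := fun y => sq F (F x) y + S y.
  have [PsF PsFE] := Psq F (F x) PF.
  have PT : P T by exact: fixed_add.
  pose t z : RR := (re (Phi F z - F x) ^+ 2 + im (Phi F z - F x) ^+ 2) +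
    \sum_(i < n) (re (coord i z - U i x) ^+ 2 + im (coord i z - U i x) ^+ 2).
  have TE z : Phi T z = ((t z)%:C)%C.
    rewrite /T PhiD // PsFE /S Phi_sum => [|i]; last exact: (Psq _ _ (UP i).1).1.
    rewrite /t rmorphD /= sqnormE; congr (_ + _); rewrite rmorph_sum.
    apply: eq_bigr => i _; rewrite (Psq _ _ (UP i).1).2 (UP i).2 /=.
    exact: sqnormE.
  have t0 z : 0 < t z.
    have sq0 (c : CC) : 0 <= re c ^+ 2 + im c ^+ 2 by rewrite addr_ge0 ?sqr_ge0.
    have sq_eq0 (c : CC) : re c ^+ 2 + im c ^+ 2 = 0 -> c = 0.
      move=> /eqP; rewrite paddr_eq0 ?sqr_ge0 // !sqrf_eq0 => /andP [/eqP a /eqP b].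
      by case: c a b => a b; rewrite /re /im /= => -> ->.
    rewrite lt_neqAle addr_ge0 ?sumr_ge0 // andbT eq_sym.
    apply/negP; rewrite paddr_eq0 ?sumr_ge0 // => /andP [/eqP /sq_eq0 Fz].
    rewrite psumr_eq0 // => /allP zx; apply: Fx.
    have -> : q x = z.
      apply: torus_ext => i; rewrite qP; apply/esym/eqP; rewrite -subr_eq0; apply/eqP.
      by apply: sq_eq0; apply/eqP; exact: (zx i (mem_index_enum i)).
    by apply/esym/eqP; rewrite -subr_eq0 Fz.
  have tc : continuous t.
    have /continuous_complexP [+ _] : continuous (Phi T) by exact: PhiP.
    by have -> : re \o Phi T = t by apply/funext => z /=; rewrite TE.
  (* Surjectivity of [Phi] brings the inverse back to the dual, where it contradicts [T x = 0]. *)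
  have [H [PH HE]] : exists H, P H /\ Phi H = fun z => (((t z)^-1)%:C)%C.
    apply: pre; apply: continuous_realC => z.
    exact: (cvgV (lt0r_neq0 (t0 z)) (tc z)).
  have TH : (fun y => T y * H y) = fun=> 1.
    apply: inj; [exact: fixed_mul|exact: fixed_cst|].
    rewrite PhiM // HE Phi1; apply/funext => z.
    by rewrite TE -rmorphM divff // gt_eqF.
  have : T x * H x = 1 by move/(congr1 (fun f => f x)): TH.
  have -> : T x = 0.
    rewrite /T /S /sq subrr mul0r add0r big1 // => i _.
    by rewrite subrr mul0r.
  by rewrite mul0r => /esym/eqP; rewrite oner_eq0.
have comp F : P F -> F = Phi F \o q by move=> PF; apply/funext => x; exact: key.
exists q; split.
- by move=> F PF; exists (Phi F); [exact: PhiP|exact: comp].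
- by move=> f /pre [F [PF <-]]; rewrite -comp.
- move=> f f' /pre [F [PF <-]] /pre [F' [PF' <-]].
  by rewrite -!comp // => ->.
Qed.

End Gelfand.

(** * Maps at bounded distance from the identity *)

Lemma fin_min n (r : 'I_n -> RR) : (forall i, 0 < r i) ->
  exists2 r0 : RR, 0 < r0 & forall i, r0 <= r i.
Proof.
move=> r0; exists (\big[Num.min/1]_i r i) => [|i]; last exact: bigmin_le_cond.
by elim/big_ind: _ => // x y x0 y0; rewrite lt_min x0.
Qed.

(* An approximate form of Brouwer's theorem, for which Kuhn's lemma is enough: the map
   [y |-> y + H y] is in fact onto. *)
Lemma near_identity_dense n (H : ('I_n -> RR) -> 'I_n -> RR) (M : RR) :
  (forall y i, `|H y i| < M) ->
  (forall i eps, 0 < eps -> exists2 r, 0 < r &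
    forall y y', (forall j, `|y j - y' j| < r) -> `|H y i - H y' i| < eps) ->
  forall (w : 'I_n -> RR) eps, 0 < eps -> exists y, forall i, `|y i + H y i - w i| < eps.
Proof.
move=> HM Hu w eps eps0; have e40 : 0 < eps / 4 by rewrite divr_gt0.
have [r rP] : exists r : 'I_n -> RR, forall i, 0 < r i /\
    forall y y', (forall j, `|y j - y' j| < r i) -> `|H y i - H y' i| < eps / 4.
  suff /choice [r rP] : forall i, exists r, 0 < r /\
      forall y y', (forall j, `|y j - y' j| < r) -> `|H y i - H y' i| < eps / 4 by exists r.
  by move=> i; have [r r0 h] := Hu i _ e40; exists r.
have [r0 r0p r0P] := fin_min (fun i => (rP i).1).
(* A grid step below [r1] moves both the point and [H] by less than [eps / 4]. *)
pose r1 := Num.min r0 (eps / 4).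
have r1p : 0 < r1 by rewrite lt_min r0p.
case: n H HM Hu w r rP r0P => [|n] H HM Hu w r rP r0P; first by exists (fun=> 0) => -[].
have M0 : 0 < M by apply: le_lt_trans (HM (fun=> 0) ord0).
pose q := Num.truncn (2 * M / r1).
have qP : 2 * M / r1 < q.+1%:R by exact: truncnS_gt.
pose step : RR := 2 * M / q.+1%:R.
have p0 : 0 < (q.+1%:R : RR) by rewrite ltr0n.
have step0 : 0 < step by rewrite divr_gt0 // mulr_gt0.
have stepr : step < r1.
  by rewrite /step ltr_pdivrMr // [ltRHS]mulrC -ltr_pdivrMr.
(* A grid on the cube of half side [M] around [w], labelled by the sign of [y + H y - w]; since [H]
   stays below [M], opposite faces get opposite signs. *)
pose Y (x : 'I_n.+1 -> nat) := fun j => w j - M + step * (x j)%:R.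
pose f (i : 'I_n.+1) x := 0 < Y x i + H (Y x) i - w i.
have [||x [y [z [xyz fyz]]]] := @kuhn n.+1 q f.
- move=> i x xi; apply/negbTE; rewrite /f -leNgt.
  have -> : Y x i = w i - M by rewrite /Y xi mulr0 addr0.
  by have := HM (Y x) i; rewrite ltr_norml => /andP [_]; lra.
- move=> i x xi; have sp : step * q.+1%:R = 2 * M by rewrite /step divfK // gt_eqF.
  rewrite /f.
  have -> : Y x i = w i + M by rewrite /Y xi sp; lra.
  by have := HM (Y x) i; rewrite ltr_norml => /andP [+ _]; lra.
have Yd (x' : 'I_n.+1 -> nat) j : (x j <= x' j <= (x j).+1)%N -> `|Y x' j - Y x j| <= step.
  move=> /andP [a b]; rewrite /Y opprD addrACA subrr add0r -mulrBr normrM gtr0_norm //.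
  have step0' := ltW step0; apply: ler_piMr => //.
  rewrite -natrB // ger0_norm ?ler0n //.
  by rewrite lern1 leq_subLR addn1.
have Fd (x' : 'I_n.+1 -> nat) i : (forall j, (x j <= x' j <= (x j).+1)%N) ->
    `|(Y x' i + H (Y x') i) - (Y x i + H (Y x) i)| < eps / 2.
  move=> h; rewrite opprD addrACA; apply: le_lt_trans (ler_normD _ _) _.
  have -> : eps / 2 = eps / 4 + eps / 4 by lra.
  apply: ltrD.
    apply: le_lt_trans (Yd x' i (h i)) _; apply: lt_le_trans stepr _.
    by rewrite ge_min lexx orbT.
  apply: (rP i).2 => j; apply: le_lt_trans (Yd x' j (h j)) _.
  apply: lt_le_trans stepr _; rewrite ge_min; apply/orP; left; exact: r0P.
exists (Y x) => i.
(* Each coordinate has a nonpositive and a positive value within [eps / 2] of its value at [Y x],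
   which is therefore small. *)
have := Fd (y i) i (fun j => (xyz i j).1); have := Fd (z i) i (fun j => (xyz i j).2).
have := fyz i; rewrite /f !ltr_norml.
case: ltP => a; case: ltP => b //= _ /andP [? ?] /andP [? ?]; apply/andP; split; lra.
Qed.

(** * Finite orbits *)

Section FiniteOrbits.
Variables (G : groupType) (A : zmodType) (act : G -> A -> A).
Hypothesis hA : torsion_free A.
Hypothesis hact : action_by_automorphisms act.

Let actD g : additive_map (act g).
Proof. by have [h _ _] := hact => a b; exact: h. Qed.

Let act1 a : act 1%g a = a.
Proof. by have [_ h _] := hact. Qed.

Let actM g h a : act (g * h)%g a = act g (act h a).
Proof. by have [_ _ h'] := hact. Qed.

Lemma act_inj g : injective (act g).
Proof. by move=> a b ab; rewrite -(act1 a) -(act1 b) -(mulVg g) !actM ab. Qed.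

Lemma orbit_seq c : finite_orbits act ->
  exists s : seq A, uniq s /\ forall b, b \in s <-> exists g, b = act g c.
Proof.
move=> /(_ c) /finite_seqP [s sE]; exists (undup s); split; first exact: undup_uniq.
move=> b; rewrite mem_undup; have -> : (b \in s) = ([set` s] b) :> Prop by [].
rewrite -sE; split=> [[g _ <-]|[g ->]]; first by exists g.
by exists g.
Qed.

(* Average over the permutations of the orbit induced by [G]. *)
Lemma orbit_relation (s : seq A) (c : A) (k : 'I_(size s) -> int) :
  uniq s -> (forall b, b \in s <-> exists g, b = act g c) ->
  (forall g, act g (comb (fun i => s`_i) k) = comb (fun i => s`_i) k) ->
  \sum_i k i = 0 -> comb (fun i => s`_i) k = 0.
Proof.
move=> us sP dG k0; set d := comb _ _ in dG *.
have nthI (i j : 'I_(size s)) : s`_i = s`_j -> i = j.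
  by move=> /eqP; rewrite nth_uniq // => /eqP; exact: val_inj.
have smem (i : 'I_(size s)) : s`_i \in s by rewrite mem_nth.
have /choice [p pP] : forall g, exists p : 'S_(size s), forall i : 'I_(size s), s`_(p i) = act g s`_i.
  move=> g; have /choice [f fP] : forall i : 'I_(size s), exists j : 'I_(size s), s`_j = act g s`_i.
    move=> i; have [h hE] := (sP _).1 (smem i).
    have : act g s`_i \in s by apply/sP; exists (g * h)%g; rewrite actM hE.
    by move=> /(nthP 0) [j lj jE]; exists (Ordinal lj).
  have f_inj : injective f.
    by move=> i j ij; apply: nthI; apply: (@act_inj g); rewrite -!fP ij.
  by exists (perm f_inj) => i; rewrite permE.
(* The image of [G] in the permutations of the orbit: averaging over it is a finite sum even if [G]
   is infinite. *)
pose Gam := [set r : 'S_(size s) | `[< exists g, r = p g >]]%SET.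
have p_inj (r r' : 'S_(size s)) : (forall i : 'I_(size s), s`_(r i) = s`_(r' i)) -> r = r'.
  by move=> h; apply/permP => i; exact: nthI.
have GamM g (r : 'S_(size s)) : ((p g * r)%g \in Gam) = (r \in Gam).
  rewrite !inE; apply/asboolP/asboolP => -[h hE].
    exists (h * g^-1)%g; apply: p_inj => i; rewrite pP actM.
    have [j jE] : exists j, p g j = i by exists ((p g)^-1 i)%g; rewrite permKV.
    rewrite -jE [s`_(p g j)]pP -[act g^-1 _]actM mulVg act1 -pP -hE permM //.
  exists (h * g)%g; apply: p_inj => i; by rewrite permM hE !pP actM.
(* By transitivity this does not depend on [i], so the averaged combination is a multiple of the
   coefficient sum, which is zero. *)
pose mass (i : 'I_(size s)) := \sum_(r in Gam) s`_(r i).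
have massE i j : mass i = mass j.
  have [gi giE] := (sP _).1 (smem i); have [gj gjE] := (sP _).1 (smem j).
  have ji : p (gi * gj^-1)%g j = i.
    by apply: nthI; rewrite pP actM gjE -[act gj^-1 _]actM mulVg act1 giE.
  rewrite /mass [RHS](reindex_inj (mulgI (p (gi * gj^-1)%g))) /=.
  apply: eq_big => [r|r _]; first by rewrite GamM.
  by rewrite permM ji.
have sum_d : d *+ #|Gam| = \sum_i mass i *~ k i.
  rewrite -sumr_const.
  have -> : \sum_(r in Gam) d = \sum_(r in Gam) \sum_i s`_(r i) *~ k i.
    apply: eq_bigr => r; rewrite inE => /asboolP [g ->].
    rewrite -(dG g) /d /comb additive_sum //; apply: eq_bigr => i _.
    by rewrite additiveMz // pP.
  rewrite exchange_big /=; apply: eq_bigr => i _.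
  by rewrite -mulrz_suml.
have Gam0 : (0 < #|Gam|)%N.
  by apply/card_gt0P; exists (p 1%g); rewrite inE; apply/asboolP; exists 1%g.
apply: (hA Gam0); rewrite sum_d.
case: (posnP (size s)) => [s0|s0].
  by apply: big1 => i _; exfalso; have := ltn_ord i; rewrite [ltnRHS]s0 ltn0.
rewrite (eq_bigr (fun i => mass (Ordinal s0) *~ k i)) => [|i _].
  by rewrite -mulrz_sumr k0 mulr0z.
by rewrite (massE i (Ordinal s0)).
Qed.

(** Prescribe [v] on the [a i] and [0] on orbit combinations with coefficient sum zero, then extend.
    This is consistent: such a combination lying in the span of [a] is fixed by [G], hence zero by
    [orbit_relation]. *)
Lemma hom_const_on_orbit n (a : 'I_n -> A) (v : 'I_n -> RR) (s : seq A) (c : A) :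
  independent a -> (forall g i, act g (a i) = a i) ->
  uniq s -> (forall b, b \in s <-> exists g, b = act g c) ->
  exists l : A -> RR, [/\ additive_map l, forall i, l (a i) = v i &
    forall b b', b \in s -> b' \in s -> l b = l b'].
Proof.
move=> ia aG us sP; pose o (i : 'I_(size s)) := s`_i.
pose S := [set x : A * RR | exists k k0, \sum_i k0 i = 0 /\
  x = (comb a k + comb o k0, \sum_i v i *~ k i)].
have aGk g k : act g (comb a k) = comb a k.
  by rewrite additive_comb //; apply: eq_bigr => i _; rewrite aG.
have [|l la lS] := @extend_hom A hA S.
  split.
  - exists (fun=> 0), (fun=> 0); split; first by rewrite big1.
    by congr (_, _); rewrite ?/comb !big1 ?addr0.
  - move=> _ _ [k [k0 [k00 ->]]] [k' [k0' [k00' ->]]].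
    exists (fun i => k i - k' i), (fun i => k0 i - k0' i); split.
      by rewrite sumrB k00 k00' subr0.
    congr (_, _) => /=; first by rewrite -!combB opprD addrACA.
    by rewrite -sumrB; apply: eq_bigr => i _; rewrite mulrzBr.
  - move=> r [k [k0 [k00 [e ->]]]].
    have oE : comb o k0 = - comb a k by apply/eqP; rewrite -addr_eq0 addrC -e.
    have o0 : comb o k0 = 0.
      by apply: (orbit_relation us sP) => // g; rewrite -/o oE additiveN // aGk.
    move: oE; rewrite o0 => /esym/eqP; rewrite oppr_eq0 => /eqP /ia kz.
    by rewrite big1 // => i _; rewrite kz.
exists l; split => //.
- move=> j; rewrite -[a j](comb_delta a j) (lS (_, v j)) //=.
  exists (fun i => (i == j)%:R), (fun=> 0); split; first by rewrite big1.
  congr (_, _); first by rewrite [comb o _]/comb [X in _ = _ + X]big1 ?addr0.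
  rewrite (bigD1 j) //= eqxx mulr1z big1 ?addr0 // => i /negbTE ->.
  by rewrite mulr0z.
- move=> b b' /(nthP 0) [i li <-] /(nthP 0) [j lj <-].
  apply/eqP; rewrite -subr_eq0 -additiveN // -la; apply/eqP.
  apply: (lS (_, 0)); exists (fun=> 0), (fun k => (k == Ordinal li)%:R - (k == Ordinal lj)%:R).
  split; last first.
    congr (_, _); last by rewrite big1.
    by rewrite -combB !comb_delta [comb a _]/comb big1 ?add0r.
  rewrite sumrB (bigD1 (Ordinal li)) //= [X in _ - X](bigD1 (Ordinal lj)) //= !eqxx.
  by rewrite !big1 ?addr0 ?subrr // => k /negbTE ->.
Qed.

End FiniteOrbits.

(** * The torus as the dual of Z^n *)

Section TorusDual.
Variable n : nat.
Local Notation Zn := 'rV[int]_n.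

Lemma torsion_free_Zn : torsion_free Zn.
Proof.
move=> a k k0 /rowP ak; apply/rowP => j; have := ak j; rewrite !mxE mulmxnE.
by move=> /eqP; rewrite mulrn_eq0 gtn_eqF //= => /eqP.
Qed.

Definition basis_Zn (i : 'I_n) : Zn := delta_mx 0 i.

Lemma comb_basis_Zn (k : Zn) : comb basis_Zn (fun i => k 0 i) = k.
Proof.
by rewrite [RHS](row_sum_delta k); apply: eq_bigr => j _; rewrite -scaler_int intz.
Qed.

Lemma comb_closed (A : zmodType) (C : A -> Prop) m (b : 'I_m -> A) k :
  C 0 -> (forall x y, C x -> C y -> C (x + y)) -> (forall x, C x -> C (- x)) ->
  (forall i, C (b i)) -> C (comb b k).
Proof.
move=> C0 CD CN Cb.
have Cn i j : C (b i *+ j) by elim: j => [|j IH]; rewrite ?mulr0n // mulrS; exact: CD.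
rewrite /comb; elim/big_rec: _ => // i x _; apply: CD.
by case: (k i) => j; rewrite ?NegzE ?mulrNz; [|apply: CN]; exact: Cn.
Qed.

Lemma continuous_ev_comb (A : zmodType) (T : topologicalType) (g : T -> dual A)
    m (b : 'I_m -> A) k :
  (forall i, continuous (fun t => ev (b i) (g t))) -> continuous (fun t => ev (comb b k) (g t)).
Proof.
move=> gb; apply: (@comb_closed A (fun a => continuous (fun t => ev a (g t)))) gb.
- by under eq_fun do rewrite ev0; exact: cst_continuous.
- move=> a c Ca Cc; suff -> : (fun t => ev (a + c) (g t)) = fun t => ev a (g t) * ev c (g t).
    exact: (@continuous_mulC T (fun t => ev a (g t)) (fun t => ev c (g t)) Ca Cc).
  by apply/funext => t; rewrite evD.
- move=> a Ca; suff -> : (fun t => ev (- a) (g t)) = fun t => (ev a (g t))^*.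
    exact: (@continuous_conjC T (fun t => ev a (g t)) Ca).
  apply/funext => t; apply: (mulfI (ev_neq0 a (g t))).
  by rewrite -evD subrr ev0 -normCK norm_ev expr1n.
Qed.

Lemma dual_Zn_torus : exists pt : dual Zn -> torus n, continuous pt /\
  forall i x, coord i (pt x) = ev (basis_Zn i) x.
Proof.
have /choice [pt ptE] : forall x : dual Zn, exists z : torus n, forall i, coord i z = ev (basis_Zn i) x.
  by move=> x; apply: torus_mk => i; exact: norm_ev.
exists pt; split => //; apply: continuous_torus_map => i.
by under eq_fun do rewrite ptE; exact: continuous_ev.
Qed.

Lemma torus_dual_Zn : exists tz : torus n -> dual Zn, continuous tz /\
  forall i z, ev (basis_Zn i) (tz z) = coord i z.
Proof.
have /choice [tz tzE] : forall z : torus n, exists x : dual Zn, forall i, ev (basis_Zn i) x = coord i z.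
  move=> z; have /choice [t tE] : forall i, exists t, coord i z = expi t.
    by move=> i; have [t _ tE] := expi_surj (norm_coord i z); exists t.
  have [k l|k|x xE] := @dual_mk Zn (fun k => expi (\sum_i t i *~ k 0 i)).
  - by rewrite -expiD -big_split; congr expi; apply: eq_bigr => i _; rewrite mxE mulrzDr.
  - exact: norm_expi.
  exists x => i; rewrite xE tE; congr expi; rewrite (bigD1 i) //= mxE !eqxx mulr1z.
  by rewrite big1 ?addr0 // => j /negbTE ji; rewrite mxE ji andbF mulr0z.
exists tz; split => //; apply: continuous_dual => k; rewrite -(comb_basis_Zn k).
apply: continuous_ev_comb => i; under eq_fun do rewrite tzE.
exact: continuous_tcoord.
Qed.

Lemma dual_Zn_ext (x y : dual Zn) :
  (forall i, ev (basis_Zn i) x = ev (basis_Zn i) y) -> x = y.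
Proof.
move=> xy; apply: dual_ext => k; rewrite -(comb_basis_Zn k).
have /choice [t tE] : forall i, exists t, ev (basis_Zn i) x = expi t.
  by move=> i; have [t _ tE] := expi_surj (norm_ev (basis_Zn i) x); exists t.
by rewrite !(@ev_comb _ _ _ _ _ t) // => i; rewrite -xy.
Qed.

End TorusDual.

(** * Fixed point algebras isomorphic to C(torus n) *)

Lemma sum_cst_seq (V : zmodType) (T : eqType) (s : seq T) (v : V) : \sum_(b <- s) v = v *+ size s.
Proof. by rewrite big_const_seq count_predT iter_addr addr0. Qed.

Lemma continuous_sumR (X : topologicalType) (I : Type) (r : seq I) (u : I -> X -> RR) :
  (forall i, continuous (u i)) -> continuous (fun x => \sum_(i <- r) u i x).
Proof.
move=> uc; elim: r => [|i r IH] x.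
  suff -> : (fun x => \sum_(i <- [::]) u i x) = fun=> 0 by exact: cst_continuous.
  by apply/funext => y; rewrite big_nil.
suff -> : (fun x => \sum_(j <- i :: r) u j x) = fun x => u i x + \sum_(j <- r) u j x.
  exact: (cvgD (@uc i x) (@IH x)).
by apply/funext => y; rewrite big_cons.
Qed.

Section FixedAlgebraTorus.
Variables (G : groupType) (A : zmodType) (act : G -> A -> A) (n : nat).
Hypothesis hA : torsion_free A.
Hypothesis hact : action_by_automorphisms act.
Hypothesis horb : finite_orbits act.
Variable q : dual A -> torus n.
Local Notation P := (fixed_point_algebra act).
Hypothesis q_surj : forall F, P F -> exists2 f : torus n -> CC, continuous f & F = f \o q.
Hypothesis q_fixed : forall f : torus n -> CC, continuous f -> P (f \o q).
Hypothesis q_inj : forall f f' : torus n -> CC, continuous f -> continuous f' ->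
  f \o q = f' \o q -> f = f'.

Lemma q_lift : exists (a : 'I_n -> A) (h : 'I_n -> dual A -> RR),
  (forall i, continuous (h i)) /\
  (forall i x, coord i (q x) = ev (a i) x * expi (h i x)).
Proof.
have cq i : continuous (fun x => coord i (q x)).
  by have [] := q_fixed (@continuous_tcoord n i).
have /choice [ah ahP] : forall i, exists ah : A * (dual A -> RR), continuous ah.2 /\
    forall x, coord i (q x) = ev ah.1 x * expi (ah.2 x).
  move=> i; have [|a [h [hc hE]]] := unitary_lift hA (cq i).
    by move=> x; exact: norm_coord.
  by exists (a, h).
exists (fun i => (ah i).1), (fun i => (ah i).2); split=> i; first exact: (ahP i).1.
exact: (ahP i).2.
Qed.

Lemma dual_act : exists tw : G -> dual A -> dual A,
  (forall g, continuous (tw g)) /\ forall g a x, ev a (tw g x) = ev (act g a) x.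
Proof.
have [actD _ _] := hact.
have /choice [tw twE] : forall gx : G * dual A, exists y : dual A, forall a, ev a y = ev (act gx.1 a) gx.2.
  by move=> [g x]; apply: dual_mk => [a b|a] /=; [rewrite actD evD|exact: norm_ev].
exists (fun g x => tw (g, x)); split=> [g|g a x]; last exact: (twE (g, x)).
by apply: continuous_dual => a; under eq_fun do rewrite twE /=; exact: continuous_ev.
Qed.

Lemma fixedP F : P F -> forall (tw : G -> dual A -> dual A),
  (forall g a x, ev a (tw g x) = ev (act g a) x) -> forall g x, F (tw g x) = F x.
Proof. by move=> [_ iF] tw twE g x; apply: (iF g) => a; exact: twE. Qed.

Variables (a : 'I_n -> A) (h : 'I_n -> dual A -> RR).
Hypothesis hc : forall i, continuous (h i).
Hypothesis qE : forall i x, coord i (q x) = ev (a i) x * expi (h i x).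

(** Invariance of [q] exhibits the character [act g (a i) - a i] as the exponential of a difference
    of lifts. *)
Lemma basis_fixed g i : act g (a i) = a i.
Proof.
have [tw [twc twE]] := dual_act.
apply/eqP; rewrite -subr_eq0; apply/eqP.
apply: (@ev_bounded A hA (fun x => h i x - h i (tw g x))) => [|x].
  move=> x; apply: (cvgB (@hc i x)).
  exact: (cvg_comp _ _ (twc g x) (@hc i (tw g x))).
have := fixedP (q_fixed (@continuous_tcoord n i)) twE g x.
rewrite /= !qE twE expiB => E; apply: (mulIf (ev_neq0 (a i) x)).
rewrite -evD subrK; apply: (mulIf (expi_neq0 (h i (tw g x)))).
by rewrite E mulrAC divfK ?expi_neq0 // mulrC.
Qed.

(** The difference [D] takes values in [2 * pi * Z], is constant along one-parameter subgroups and
    vanishes at the trivial character; as these subgroups are dense, uniform continuity gives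
    [|D x| < 1]. *)
Lemma lift_fixed g i (tw : G -> dual A -> dual A) : (forall g, continuous (tw g)) ->
  (forall g a x, ev a (tw g x) = ev (act g a) x) -> forall x, h i (tw g x) = h i x.
Proof.
move=> twc twE x; have [actD _ _] := hact.
pose D y := h i (tw g y) - h i y.
have Dc : continuous D.
  move=> y; apply: cvgB (@hc i y).
  exact: (cvg_comp _ _ (twc g y) (@hc i (tw g y))).
have D1 y : expi (D y) = 1.
  have := fixedP (q_fixed (@continuous_tcoord n i)) twE g y.
  rewrite /= !qE twE basis_fixed => /(mulfI (ev_neq0 _ _)) E.
  by rewrite /D expiB E divff // expi_neq0.
have [s [d [d0 sd]]] := uniform_close (continuous_realC Dc) (@ltr01 RR).
have [l la lE] := ev_lift hA x s.
have [e ec eE] := exp_line la.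
have De t : D (e t) = D (e 0).
  apply: (@expi_lift_const (D \o e)) => {}t; last exact: D1.
  exact: (cvg_comp _ _ (ec t) (Dc (e t))).
have De0 : D (e 0) = 0.
  suff e0 : tw g (e 0) = e 0 by rewrite /D e0 subrr.
  by apply: dual_ext => b; rewrite twE !eE !mul0r.
have xe : close_on s d (e 1) x by move=> b /lE; rewrite eE mul1r => ->; exact: close_refl.
have [Dlt _] := sd _ _ xe; rewrite /re /= De De0 sub0r normrN in Dlt.
apply/eqP; rewrite -subr_eq0 -/(D x); apply/eqP; apply: expi_inj_lt.
  by rewrite D1 expi0.
by rewrite subr0; apply: lt_trans Dlt _; have := pi_ge2 RR; lra.
Qed.

(** [ev k (tz z)] is the monomial with exponents [k] in the coordinates of [z]. *)
Lemma q_pullback x (tz : torus n -> dual 'rV[int]_n) (k : 'rV[int]_n) :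
  (forall i z, ev (basis_Zn i) (tz z) = coord i z) ->
  ev k (tz (q x)) = ev (comb a (fun i => k 0 i)) x * expi (\sum_i h i x *~ k 0 i).
Proof.
move=> tzE; have /choice [t tE] : forall i, exists t, ev (a i) x = expi t.
  by move=> i; have [t _ tE] := expi_surj (norm_ev (a i) x); exists t.
rewrite (ev_comb _ tE) -expiD -big_split -[in LHS](comb_basis_Zn k).
rewrite (@ev_comb _ _ _ _ _ (fun i => t i + h i x)) => [|i]; last first.
  by rewrite tzE qE tE expiD.
by congr expi; apply: eq_bigr => i _; rewrite mulrzDl.
Qed.

Lemma continuous_lift_sum (k : 'I_n -> int) : continuous (fun x => \sum_i h i x *~ k i).
Proof.
apply: continuous_sumR => i x.
suff -> : (fun x => h i x *~ k i) = fun x => h i x * (k i)%:~R.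
  by apply: (cvgM (@hc i x)); exact: cvg_cst.
by apply/funext => y; rewrite mulrzr.
Qed.

(** A relation [k] makes the monomial of exponent [k], pulled back by [q], the exponential of the
    invariant function [H]. As [H] factors through [q] and [q] separates functions on the torus,
    that monomial is already an exponential there, so [k = 0] by [ev_bounded] for [Z^n]. *)
Lemma basis_independent : independent a.
Proof.
move=> k ak i; pose K : 'rV[int]_n := \row_j k j.
have KE : (fun i => K 0 i) = k by apply/funext => j; rewrite mxE.
suff : K = 0 by move=> /rowP /(_ i); rewrite !mxE.
have [tz [tzc tzE]] := torus_dual_Zn n; have [pt [ptc ptE]] := dual_Zn_torus n.
have [tw [twc twE]] := dual_act.
pose H x := \sum_i h i x *~ k i.
have Hc : continuous H by exact: continuous_lift_sum.
have PH : P (fun x => ((H x)%:C)%C).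
  split; first exact: continuous_realC.
  move=> g x y xy; congr (_%:C)%C; apply: eq_bigr => j _.
  have -> : y = tw g x by apply: dual_ext => b; rewrite twE; exact: xy.
  by rewrite lift_fixed.
have [f fc fE] := q_surj PH.
have fE' x : f (q x) = ((H x)%:C)%C by have /(congr1 (fun u => u x)) := fE.
have /continuous_complexP [rfc _] := fc.
have E : (fun z => ev K (tz z)) = fun z => expi (re (f z)).
  apply: q_inj.
  - by move=> z; exact: (cvg_comp _ _ (tzc z) (@continuous_ev _ K (tz z))).
  - exact: (continuous_expi rfc).
  - apply/funext => x /=; rewrite (q_pullback x K tzE) KE ak ev0 mul1r fE'.
    by congr expi; apply: eq_bigr => j _; rewrite mxE.
apply: (@ev_bounded _ (@torsion_free_Zn n) (fun x => re (f (pt x)))) => [|x].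
  by move=> x; exact: (cvg_comp _ _ (ptc x) (rfc (pt x))).
have -> : x = tz (pt x) by apply: dual_Zn_ext => j; rewrite tzE ptE.
have /(congr1 (fun u => u (pt x))) /= -> := E.
by congr (expi (re (f _))); apply: torus_ext => j; rewrite [RHS]ptE tzE.
Qed.

(* If [lam] is dual to [a], then [q] restricted to the corresponding [R^n -> dual A] is,
   in real coordinates, at bounded distance from the identity. *)
Lemma exp_param_dense (lam : 'I_n -> A -> RR) (e : ('I_n -> RR) -> dual A) :
  (forall y b, ev b (e y) = expi (\sum_j y j * lam j b)) ->
  (forall i j, lam j (a i) = (i == j)%:R) ->
  forall z d, 0 < d -> exists y, forall i, close d (coord i (q (e y))) (coord i z).
Proof.
move=> eE lamE z d d0; have [r r0 rP] := expi_uniform d0.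
have /choice [w wE] : forall i, exists t, coord i z = expi t.
  by move=> i; have [t _ tE] := expi_surj (norm_coord i z); exists t.
have /choice [M MP] : forall i, exists M, 0 < M /\ forall x, `|h i x| <= M.
  by move=> i; have [M M0 hM] := dual_bounded (@hc i); exists M.
have qe i y : coord i (q (e y)) = expi (y i + h i (e y)).
  rewrite qE eE expiD; congr (expi _ * _).
  by rewrite (bigD1 i) //= lamE eqxx mulr1 big1 ?addr0 // => j /negbTE ji;
     rewrite lamE eq_sym ji mulr0.
have [||y yP] := @near_identity_dense n (fun y i => h i (e y)) (1 + \sum_i M i) _ _ w r r0.
- move=> y i; apply: le_lt_trans ((MP i).2 _) _.
  rewrite (bigD1 i) //= addrA [1 + _]addrC -addrA ltrDl ltr_pwDl // sumr_ge0 // => j _.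
  exact/ltW/(MP j).1.
- move=> i eps eps0.
  have [s [d1 [d10 sd]]] := uniform_close (continuous_realC (@hc i)) eps0.
  have [r1 r10 r1P] := exp_param_uniform s eE d10.
  by exists r1 => // y y' yy; have [] := sd _ _ (r1P _ _ yy).
by exists y => i; rewrite qe wE; apply: rP; exact: yP.
Qed.

Lemma act_trivial g0 c : act g0 c = c.
Proof.
have [s [us sP]] := orbit_seq c horb.
have ai := basis_independent; have [actD act1 actM] := hact.
have /choice [lam lamP] : forall j, exists l : A -> RR, [/\ additive_map l,
    forall i, l (a i) = (i == j)%:R & forall b b', b \in s -> b' \in s -> l b = l b'].
  by move=> j; exact: (hom_const_on_orbit hA hact (fun i => (i == j)%:R) ai basis_fixed us sP).
have [e eE] := exp_param (fun j => let: And3 p _ _ := lamP j in p).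
have lamE i j : lam j (a i) = (i == j)%:R by have [_ -> _] := lamP j.
pose F x := \sum_(b <- s) ev b x.
have cs : c \in s by apply/sP; exists 1%g; rewrite act1.
have PF : P F.
  split; first by apply: continuous_sumC => b; exact: continuous_ev.
  move=> g x y xy; rewrite /F.
  have -> : \sum_(b <- s) ev b y = \sum_(b <- [seq act g b | b <- s]) ev b x.
    by rewrite big_map; apply: eq_bigr => b _; exact: xy.
  apply: perm_big; apply: uniq_perm => //.
    by rewrite map_inj_uniq //; exact: (act_inj hact).
  move=> b; apply/mapP/idP => [[b' /sP [g' ->] ->]|/sP [g' ->]].
    by apply/sP; exists (g * g')%g; rewrite actM.
  exists (act (g^-1 * g')%g c); first by apply/sP; exists (g^-1 * g')%g.
  by rewrite -actM mulgA mulgV mul1g.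
have PN : P (fun x => sqnorm (F x)) by apply: fixed_mul => //; exact: fixed_conj.
have [f fc fE] := q_surj PN.
have fq x : sqnorm (F x) = f (q x) by have /(congr1 (fun u => u x)) := fE.
pose r : CC := (size s)%:R.
have Fe y : sqnorm (F (e y)) = r ^+ 2.
  have -> : F (e y) = r * expi (\sum_j y j * lam j c).
    rewrite /F /r mulr_natl -sum_cst_seq big_seq [RHS]big_seq; apply: eq_bigr => b bs.
    rewrite eE; congr expi; apply: eq_bigr => j _.
    by have [_ _ lo] := lamP j; rewrite (lo _ _ bs cs).
  by rewrite /sqnorm -normCK normrM norm_expi mulr1 /r normr_nat.
(* The points [q (e y)], where the value is [r ^+ 2], are dense in the torus. *)
have f_const z : f z = r ^+ 2.
  apply: contrapT => fz.
  have [t t0 tP] : exists2 t : RR, 0 < t & ~ close t (r ^+ 2) (f z).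
    apply: contrapT => /forall2NP H; apply: fz.
    have eq_small (p q0 : RR) : (forall t : RR, 0 < t -> `|p - q0| < t) -> q0 = p.
      move=> pq; apply/eqP; rewrite eq_sym -subr_eq0 -normr_le0 leNgt; apply/negP => lt0.
      by have := pq _ lt0; rewrite ltxx.
    have Hc t : 0 < t -> close t (r ^+ 2) (f z).
      by move=> t0; have [//|/contrapT] := H t.
    apply/eqP; rewrite eq_complex; apply/andP; split; apply/eqP; apply: eq_small => t /Hc [] //.
  have /nbhs_torusP [d d0 dP] := fc z _ (nbhs_close (f z) t0).
  have [y /dP] := exp_param_dense eE lamE z d0.
  by rewrite /= -fq Fe.
have FN x : `|F x| = \sum_(b <- s) `|ev b x|.
  under eq_bigr do rewrite norm_ev.
  rewrite sum_cst_seq; apply/eqP; rewrite -(@eqrXn2 _ 2) ?ler0n //.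
  by rewrite normCK -/(sqnorm _) fq f_const.
(* The equality case of the triangle inequality for numbers of modulus one. *)
have ev_eq x b : b \in s -> ev b x = ev c x.
  move=> bs; have [i li iE] := nthP 0 bs; have [j lj jE] := nthP 0 cs.
  have : `|\sum_(k < size s) ev s`_k x| = \sum_(k < size s) `|ev s`_k x|.
    by move: (FN x); rewrite /F (big_nth 0) big_mkord [RHS](big_nth 0) [RHS]big_mkord.
  move=> /normC_sum_eq1 [k _|t _ tE]; first exact: norm_ev.
  have := tE (Ordinal li) isT; have := tE (Ordinal lj) isT; rewrite /= iE jE.
  by move=> -> ->.
apply/eqP; rewrite -subr_eq0; apply/eqP.
apply: (@ev_bounded A hA (fun=> 0)) => [|x]; first exact: cst_continuous.
apply: (mulIf (ev_neq0 c x)); rewrite expi0 mul1r -evD subrK.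
by apply: ev_eq; apply/sP; exists g0.
Qed.

Lemma basis_spans b : spanned a b.
Proof.
have [tz [tzc tzE]] := torus_dual_Zn n; have [pt [ptc ptE]] := dual_Zn_torus n.
have Pb : P (ev b).
  split; first exact: continuous_ev.
  by move=> g x y xy; rewrite /ev xy act_trivial.
have [f fc fE] := q_surj Pb.
have fq x : ev b x = f (q x) by have /(congr1 (fun u => u x)) := fE.
have f1 z : `|f z| = 1.
  apply/sqnorm1; have : (fun z => sqnorm (f z)) = fun=> 1.
    apply: q_inj; last 1 first.
    - by apply/funext => x /=; rewrite -fq; apply/sqnorm1; exact: norm_ev.
    - exact: (continuous_mulC fc (continuous_conjC fc)).
    - exact: cst_continuous.
  by move/(congr1 (fun u => u z)).
have cf : continuous (fun x => f (pt x)).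
  by move=> x; exact: (cvg_comp _ _ (ptc x) (fc (pt x))).
have [k [h' [h'c kE]]] := unitary_lift (@torsion_free_Zn n) cf (fun x => f1 _).
exists (fun i => k 0 i); apply/eqP; rewrite -subr_eq0; apply/eqP.
have cq : continuous q.
  by apply: continuous_torus_map => i; have [] := q_fixed (@continuous_tcoord n i).
(* Pulling [f] back gives the character [comb a k] times two exponentials: the lifts of the
   coordinates of [q] and the lift [h'] of [f] itself. *)
apply: (@ev_bounded A hA (fun x => \sum_i h i x *~ k 0 i + h' (tz (q x)))) => [|x].
  have c1 : continuous (fun x => \sum_i h i x *~ k 0 i).
    exact: (@continuous_lift_sum (fun i => k 0 i)).
  by move=> x; exact: (cvgD (c1 x) (cvg_comp _ _ (cq x) (cvg_comp _ _ (tzc (q x)) (h'c (tz (q x)))))).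
have ptz : pt (tz (q x)) = q x by apply: torus_ext => i; rewrite ptE tzE.
have := kE (tz (q x)); rewrite ptz -fq (q_pullback x k tzE) => E.
apply: (mulIf (ev_neq0 (comb a (fun i => k 0 i)) x)).
by rewrite -evD subrK E expiD [RHS]mulrC mulrA.
Qed.

End FixedAlgebraTorus.

Theorem theorem2p3 (G : groupType) (A : zmodType) (act : G -> A -> A)
  (hA : torsion_free A)
  (hact : action_by_automorphisms act)
  (horb : finite_orbits act)
  (n : nat)
  (hiso : star_isomorphic (fixed_point_algebra act) (Cfun (torus n))) :
  (exists phi : A -> 'rV[int]_n,
      (forall a b, phi (a + b) = phi a + phi b) /\ bijective phi) /\
  (forall (g : G) (a : A), act g a = a).
Proof.
have [q [q1 q2 q3]] := gelfand hiso.
have [a [h [hc qE]]] := q_lift hA q2.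
split; last by move=> g c; exact: (act_trivial hA hact horb q1 q2 q3 hc qE).
have ai := basis_independent hA hact q1 q2 q3 hc qE.
have /choice [phi phiP] : forall b, exists k : 'rV[int]_n, b = comb a (fun i => k 0 i).
  move=> b; have [k ->] := basis_spans hA hact horb q1 q2 q3 hc qE b.
  by exists (\row_i k i); congr comb; apply/funext => i; rewrite mxE.
have inj (k l : 'rV[int]_n) : comb a (fun i => k 0 i) = comb a (fun i => l 0 i) -> k = l.
  move=> /eqP; rewrite -subr_eq0 combB => /eqP /ai kl.
  by apply/rowP => i; apply/eqP; rewrite -subr_eq0 kl.
exists phi; split=> [b c|].
  apply: inj; rewrite -phiP {1}(phiP b) {1}(phiP c) /comb -big_split.
  by apply: eq_bigr => i _; rewrite mxE mulrzDr.
apply: (@Bijective _ _ phi (fun k : 'rV[int]_n => comb a (fun i => k 0 i))) => [b|k].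
  by rewrite -phiP.
by apply: inj; rewrite -phiP.
Qed.
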